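(* Let $\Phi$ be a $c_0$-symbol with $c_0\ge1$ and let $l\ge1$ be an integer. Assume that $\Phi(s)=c_0s+\sum_{n=1}^{+\infty}c_nn^{-s}$ where $c_n=0$ when $p^+(n)>l$. If $C_\Phi$ is compact on $\mathcal{A}^2_\mu$, then $$\lim_{\Re(s)\to0}\frac{\|K^l_{\mu,\Phi(s)}\|_{\mathcal{A}^2_\mu}}{\|K^l_{\mu,s}\|_{\mathcal{A}^2_\mu}}=0.$$ In particular, if $C_\Phi$ is compact on $\mathcal{A}^2_\alpha$ with $\alpha>-1$, then $$\lim_{\Re(s)\to0}\frac{\Re(s)}{\Re(\Phi(s))}=0.$$
   Context: For $\theta\in\mathbb{R}$, $\mathbb{C}_\theta=\{s\in\mathbb{C}:\Re(s)>\theta\}$ and $\mathbb{C}_+=\mathbb{C}_0$. $\mathcal{D}$ is the class of functions representable by a convergent Dirichlet series in some half-plane. $\mu$ is a probability measure on $(0,+\infty)$ with $0\in\mathrm{Supp}(\mu)$ and $d\mu(\sigma)=h(\sigma)\,d\sigma$, $h\ge0$, $\|h\|_{L^1((0,+\infty))}=1$. $\mathcal{A}^2_\mu$ is the Hilbert space of Dirichlet series $f=\sum_{n\ge1}a_nn^{-s}$ with $\|f\|^2_{\mathcal{A}^2_\mu}=\sum_{n\ge1}|a_n|^2w_h(n)<\infty$, where $w_h(n)=\int_0^{+\infty}n^{-2\sigma}h(\sigma)\,d\sigma$ (analytic functions on $\mathbb{C}_{1/2}$). For $\alpha>-1$, $\mathcal{A}^2_\alpha=\mathcal{A}^2_{\mu_\alpha}$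 with $d\mu_\alpha(\sigma)=\frac{2^{\alpha+1}}{\Gamma(\alpha+1)}\sigma^\alpha e^{-2\sigma}\,d\sigma$, for which the weight is $(1+\log n)^{-(\alpha+1)}$. For an integer $c_0\ge1$, a $c_0$-symbol is an analytic function $\Phi:\mathbb{C}_{1/2}\to\mathbb{C}_{1/2}$, $\Phi(s)=c_0s+\varphi(s)$ with $\varphi\in\mathcal{D}$, such that $C_\Phi:f\mapsto f\circ\Phi$ is bounded on $\mathcal{A}^2_\mu$; for $c_0\ge1$ this is taken, following the paper, to mean that the Dirichlet series of $\varphi$ converges uniformly on $\mathbb{C}_\varepsilon$ for every $\varepsilon>0$ and $\varphi(\mathbb{C}_+)\subset\mathbb{C}_+$. Then $\Phi$ is regarded as an analytic function on $\mathbb{C}_+$. $p^+(n)$ is the greatest prime divisor of $n$ (with $p^+(1)=1$) and $p_l$ the $l$-th prime. For $s\in\mathbb{C}_+$ the partial reproducing kernel of order $l$ at $s$ is $K^l_{\mu,s}(w)=\sum_{n\ge1,\,p^+(n)\le p_l}\frac{n^{-\overline{s}-w}}{w_h(n)}$, $w\in\mathbb{C}_+$; it belongs to $\mathcal{A}^2_\mu$. $\lim_{\Re(s)\to0}F(s)=0$ means $\lim_{\theta\to0^+}\sup_{0<\Re(s)<\theta}|F(s)|=0$. *)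

(* Defs.v *)
From mathcomp Require Import all_boot all_order all_algebra.
From mathcomp Require Import complex.
From mathcomp Require Import all_classical all_reals all_analysis.

Set Implicit Arguments.
Unset Strict Implicit.
Unset Printing Implicit Defensive.

Import Order.TTheory GRing.Theory Num.Theory.
Import numFieldNormedType.Exports.

Local Open Scope classical_set_scope.
Local Open Scope ring_scope.

Lemma exists_prime_gt (m : nat) : exists p, prime p && (m < p)%N.
Proof. by have [p mp pp] := prime_above m; exists p; rewrite pp mp. Qed.

Definition next_prime (m : nat) : nat := ex_minn (exists_prime_gt m).

(** [nth_prime 1 = 2], [nth_prime 2 = 3], and so on; [nth_prime 0 = 0] is a
    junk value. *)
Definition nth_prime (l : nat) : nat := iter l next_prime 0%N.

Section Dirichlet.
Variable R : realType.

(** The alias [R[i]^o] of [R[i]] is the one that carries the topology of the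
    modulus.  [modulus] is the modulus with values in [R], whereas the norm of
    the library takes its values in [R[i]]. *)
Notation C := (R[i]^o).

Definition modulus (z : C) : R := complex.Re `|z : R[i]|.

Definition cexp (z : C) : C :=
  Complex (expR (complex.Re z) * cos (complex.Im z))
          (expR (complex.Re z) * sin (complex.Im z)).

(** [npow n s] is n^{-s}, for n >= 1. *)
Definition npow (n : nat) (s : C) : C :=
  cexp (- (s * (ln (n%:R : R))%:C%C)).

Definition halfplane (theta : R) : set C := [set s | theta < complex.Re s].

(** A Dirichlet series is given by its coefficient sequence
    [a : nat -> C]; only the entries [a n] with [n >= 1] are used. *)
Definition dirichlet_partial (a : nat -> C) (N : nat) (s : C) : C :=
  \sum_(1 <= n < N.+1) a n * npow n s.

Definition dirichlet (a : nat -> C) (s : C) : C :=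
  limn (fun N => dirichlet_partial a N s).

(** The measure h(sigma) dsigma on (0, +oo), seen as a set function on R. *)
Definition density_measure (h : R -> R) (A : set R) : \bar R :=
  (\int[lebesgue_measure]_(x in (A `&` `]0, +oo[)%R) (h x)%:E)%E.

Record admissible_density (h : R -> R) : Prop := {
  density_measurable : measurable_fun (`]0, +oo[ : set R) h ;
  density_ge0 : forall x, 0 < x -> 0 <= h x ;
  density_mass1 : density_measure h setT = 1%E ;
  density_supp0 : forall U : set R, open U -> U 0 ->
    (0 < density_measure h U)%E }.

Definition weight (h : R -> R) (n : nat) : R :=
  \int[lebesgue_measure]_(x in `]0, +oo[) (n%:R `^ (- (2 * x)) * h x).

Definition A2_sqnorm (h : R -> R) (a : nat -> C) : \bar R :=
  (\sum_(1 <= n <oo) (modulus (a n) ^+ 2 * weight h n)%:E)%E.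

(** A^2_mu through coefficient sequences: for an admissible density, the series
    of such a sequence converges on Re s > 1/2, and its sum determines the
    coefficients of index n >= 1. *)
Definition A2 (h : R -> R) : set (nat -> C) :=
  [set a | (A2_sqnorm h a < +oo)%E].

Definition A2_norm (h : R -> R) (a : nat -> C) : R :=
  Num.sqrt (fine (A2_sqnorm h a)).

(** With f, g the sums of the series a, b: g = f o Phi on Re s > 1/2. *)
Definition is_composition (Phi : C -> C) (a b : nat -> C) : Prop :=
  forall s, halfplane (2^-1) s -> dirichlet b s = dirichlet a (Phi s).

(** C_Phi is defined from A^2_mu to itself and maps bounded sequences to
    sequences having a norm-convergent subsequence. *)
Definition compact_composition (h : R -> R) (Phi : C -> C) : Prop :=
  (forall a, A2 h a -> exists2 b, A2 h b & is_composition Phi a b) /\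
  (forall (a b : nat -> nat -> C) (M : R),
    (forall k, A2 h (a k) /\ A2_norm h (a k) <= M) ->
    (forall k, A2 h (b k) /\ is_composition Phi (a k) (b k)) ->
    exists (e : nat -> nat) (g : nat -> C),
      [/\ {homo e : i j / (i < j)%N}, A2 h g &
          A2_norm h (fun n => b (e k) n - g n) @[k --> \oo] --> (0 : R)]).

(** [c] is the coefficient sequence of phi = Phi - c0 s.  Conditions
    [symbol_series] and [symbol_positive] stand for the boundedness of C_Phi;
    they also say that Phi extends to Re s > 0, the values of [Phi] there being
    those of the extension. *)
Record c0_symbol (c0 : nat) (Phi : C -> C) (c : nat -> C) : Prop := {
  symbol_analytic : forall s, halfplane (2^-1) s -> derivable Phi s 1 ;
  symbol_maps : forall s, halfplane (2^-1) s -> halfplane (2^-1) (Phi s) ;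
  symbol_series : forall eps : R, 0 < eps ->
    {uniform halfplane eps,
      dirichlet_partial c @ \oo --> (fun s : C => Phi s - c0%:R * s)} ;
  symbol_positive : forall s, halfplane 0 s ->
    halfplane 0 (Phi s - c0%:R * s) }.

(** Coefficients of w |-> K^l_{mu,s}(w), a Dirichlet series in w. *)
Definition partial_kernel (h : R -> R) (l : nat) (s : C) (n : nat) : C :=
  if (max_pdiv n <= nth_prime l)%N
  then npow n (s^*)%C / ((weight h n)%:C)%C else 0.

Definition tends_to0_at_boundary (F : C -> R) : Prop :=
  ereal_sup [set `|F s|%:E | s in [set s : C | 0 < complex.Re s < theta]]
    @[theta --> (0 : R)^'+] --> 0%E.

Definition Gamma (x : R) : R :=
  \int[lebesgue_measure]_(t in `]0, +oo[) (t `^ (x - 1) * expR (- t)).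

Definition bergman_density (alpha x : R) : R :=
  2 `^ (alpha + 1) / Gamma (alpha + 1) * x `^ alpha * expR (- (2 * x)).

End Dirichlet.

(* Main.v *)
Require Import Defs.
From mathcomp Require Import all_boot all_order all_algebra.
From mathcomp Require Import complex ring lra.
From mathcomp Require Import all_classical all_reals all_analysis measurable_realfun.
Set Implicit Arguments.
Unset Strict Implicit.
Unset Printing Implicit Defensive.
Import Order.TTheory GRing.Theory Num.Theory.
Import numFieldNormedType.Exports.
Local Open Scope classical_set_scope.
Local Open Scope ring_scope.

(** Write K(s) for the norm of the partial kernel at s, and call n smooth when
    its prime divisors are at most p_l.  The idea is that the adjoint of C_Phi
    maps the partial kernel at s to the one at Phi(s).  The normalised kernels
    tend weakly to 0 as Re s -> 0, because K(s) is unbounded whereas the pairing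
    with a fixed Dirichlet polynomial is bounded; a compact adjoint turns this
    into convergence in norm, which is the first limit.

    The argument below replaces the adjoint by coefficient sequences
    ([kernel_ratio_small]).  If K(Phi(s_k)) > eps K(s_k) with Re s_k -> 0, let
    a_k be the normalised kernel at Phi(s_k), cut off at an index so large that
    a_k(Phi(s_k)) is still at least K(Phi(s_k)) / 2, and let b_k be its image
    under C_Phi.  Along a subsequence b_k tends to some g in norm.  By the
    Cauchy-Schwarz inequality, |b_k(s_k)| is at most K(s_k) times the norms of
    b_k - g and of a tail of g, plus a constant.  These norms can be made small
    while K(s_k) tends to infinity, so |b_k(s_k)| < (eps / 2) K(s_k) for some k,
    a contradiction as soon as b_k(s_k) = a_k(Phi(s_k)).

    That equality is the delicate point, for C_Phi relates a_k and b_k on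
    Re s > 1/2 only, whereas s_k approaches the line Re s = 0.  Analytic
    continuation is avoided by absolute convergence.  Only finitely many primes
    occur, so the sum of n^{-sigma} over smooth n is finite for every sigma > 0
    ([smooth_sum_bounded]), and any Dirichlet series with smooth support which
    converges on Re s > 0 converges there absolutely.  Hence
    n^{-Phi(s)} = n^{-c0 s} exp(-phi(s) log n) expands, on all of Re s > 0, into
    an absolutely convergent Dirichlet series with smooth support
    ([represents_npow_symbol]).  As a_k is finite, so does a_k(Phi(s)), and by
    uniqueness of the coefficients ([dirichlet_unique0]) this series is b_k
    ([composition_poly_cvg]).

    For the density of index alpha, a change of scale in the Gamma integral
    shows that the weight is (1 + log n)^{-(alpha + 1)} ([weight_bergman]).
    Then K satisfies a doubling inequality: K(s)^2 <= D K(t)^2 when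
    Re t <= 2 Re s ([kernel_norm_doubling]), because every smooth n is m^2 r with
    r bounded, and the n-th term of K(s)^2 is at most a constant times the m-th
    term of K(t)^2.  If Re s / Re Phi(s) > eps, then Re Phi(s) <= 2^k Re s for a
    k depending on eps only, so K(Phi(s)) / K(s) is bounded below, against the
    first limit. *)

(** * Modulus and limits of complex sequences *)

Section Modulus.
Variable R : realType.
Notation C := (R[i]^o).

Lemma modulusE (z : C) : modulus z = Num.sqrt (complex.Re z ^+ 2 + complex.Im z ^+ 2).
Proof. by rewrite /modulus normc_def. Qed.

Lemma modulus_ge0 (z : C) : 0 <= modulus z.
Proof. by rewrite modulusE sqrtr_ge0. Qed.

Lemma modulusC (z : C) : (modulus z)%:C%C = `|z : R[i]|.
Proof. by rewrite /modulus normc_def. Qed.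

Lemma modulusM (z w : C) : modulus (z * w) = modulus z * modulus w.
Proof. by apply: (@complexI R); rewrite rmorphM /= !modulusC;
  exact: (normrM (z : R[i]) w). Qed.

Lemma modulusD (z w : C) : modulus (z + w) <= modulus z + modulus w.
Proof. by rewrite -lecR rmorphD /= !modulusC; exact: (ler_normD (z : R[i]) w). Qed.

Lemma modulusN (z : C) : modulus (- z) = modulus z.
Proof. by apply: (@complexI R); rewrite !modulusC; exact: (normrN (z : R[i])). Qed.

Lemma modulus0 : modulus (0 : C) = 0.
Proof. by rewrite modulusE /= expr0n /= addr0 sqrtr0. Qed.

Lemma modulus1 : modulus (1 : C) = 1.
Proof. by rewrite modulusE /= expr0n expr1n /= addr0 sqrtr1. Qed.

Lemma modulus_real (r : R) : modulus (r%:C%C : C) = `|r|.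
Proof. by rewrite modulusE /= expr0n addr0 sqrtr_sqr. Qed.

Lemma modulusBC (z w : C) : modulus (z - w) = modulus (w - z).
Proof. by rewrite -modulusN opprB. Qed.

Lemma modulus_eq0 (z : C) : modulus z = 0 -> z = 0.
Proof.
move=> h; apply/eqP; rewrite -(@normr_eq0 _ (R[i])).
by move: (modulusC z); rewrite h => <-.
Qed.

Lemma modulus_sum (I : Type) (r : seq I) (P : pred I) (F : I -> C) :
  modulus (\sum_(i <- r | P i) F i) <= \sum_(i <- r | P i) modulus (F i).
Proof.
elim/big_ind2 : _ => //; first by rewrite modulus0.
by move=> z a w b za wb; rewrite (le_trans (modulusD _ _))// lerD.
Qed.

Lemma le_modulus_dist (z w : C) : `|modulus z - modulus w| <= modulus (z - w).
Proof.
have h1 := modulusD (z - w) w; have h2 := modulusD (w - z) z.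
move: h1 h2; rewrite !subrK (modulusBC w z) => h1 h2.
by rewrite ler_norml; apply/andP; split; lra.
Qed.

Lemma Re_le_modulus (z : C) : `|complex.Re z| <= modulus z.
Proof. by rewrite modulusE -sqrtr_sqr ler_sqrt ?addr_ge0 ?sqr_ge0// lerDl sqr_ge0. Qed.

Lemma Im_le_modulus (z : C) : `|complex.Im z| <= modulus z.
Proof. by rewrite modulusE -sqrtr_sqr ler_sqrt ?addr_ge0 ?sqr_ge0// lerDr sqr_ge0. Qed.

Lemma modulus_le_ReIm (z : C) : modulus z <= `|complex.Re z| + `|complex.Im z|.
Proof.
case: z => a b; rewrite modulusE /=.
rewrite -[leRHS]ger0_norm ?addr_ge0// -sqrtr_sqr ler_sqrt ?sqr_ge0//.
by rewrite sqrrD !real_normK ?num_real// addrAC lerDl mulrn_wge0// mulr_ge0.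
Qed.

(** Reduces limits in [R[i]^o], whose norm takes complex values, to limits of
    real sequences, where the order is available. *)
Lemma cvg_modulusP (u : nat -> C) (l : C) :
  u @ \oo --> l <-> (fun n => modulus (u n - l)) @ \oo --> (0:R).
Proof.
split.
- move=> /(@cvgrPdist_lt R[i] R[i]^o) H; apply/cvgrPdist_lt => e e0.
  have e0' : 0 < e%:C%C by rewrite ltcR.
  near=> n.
  have : `|l - u n : R[i]| < e%:C%C by near: n; exact: (H _ e0').
  by rewrite sub0r normrN distrC -modulusC ltcR ger0_norm ?modulus_ge0.
- move=> H; apply/(@cvgrPdist_lt R[i] R[i]^o) => /= e e0.
  have [e1 e1p ee] : exists2 e1 : R, 0 < e1 & e = e1%:C%C.
    by exists (complex.Re e); case: e e0 => a b; rewrite ltcE /= =>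
      /andP[/eqP b0 a0]; rewrite ?b0.
  near=> n.
  have : `|0 - modulus (u n - l)| < e1 by near: n; move/cvgrPdist_lt : H; apply.
  rewrite sub0r normrN ger0_norm ?modulus_ge0// => h.
  suff : `|l - u n : R[i]| < e by [].
  by rewrite distrC -modulusC ee ltcR.
Unshelve. all: by end_near. Qed.

Lemma cvg_modulus_le (u : nat -> C) (l : C) (v : nat -> R) :
  (\forall n \near \oo, modulus (u n - l) <= v n) -> v @ \oo --> (0:R) ->
  u @ \oo --> l.
Proof.
move=> uv v0; apply/cvg_modulusP.
apply: (squeeze_cvgr _ (cvg_cst 0) v0).
by near=> n; rewrite modulus_ge0 /=; near: n.
Unshelve. all: by end_near. Qed.

Lemma ccvg_unique (u : nat -> C) (l m : C) :
  u @ \oo --> l -> u @ \oo --> m -> l = m.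
Proof.
move=> /cvg_modulusP ul /cvg_modulusP um.
apply/eqP; rewrite -subr_eq0; apply/eqP/modulus_eq0/eqP.
rewrite eq_le modulus_ge0 andbT.
have h : (fun n => modulus (u n - l) + modulus (u n - m)) @ \oo --> (0:R).
  by rewrite -[X in _ --> X]addr0; exact: cvgD.
apply: (cvgr_to_ge h); near=> n.
rewrite [X in _ <= X + _]modulusBC; apply: le_trans (modulusD _ _).
by rewrite addrA subrK.
Unshelve. all: by end_near. Qed.

Lemma ccvg_lim (u : nat -> C) (l : C) : u @ \oo --> l -> limn u = l.
Proof. by move=> ul; apply: (ccvg_unique _ ul); apply/cvg_ex; exists l. Qed.

Lemma ccvg_cst (l : C) : (fun=> l) @ \oo --> l.
Proof.
apply: (@cvg_modulus_le _ _ (fun=> 0)); last exact: cvg_cst.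
by near=> n; rewrite subrr modulus0.
Unshelve. all: by end_near. Qed.

Lemma ccvg_modulus (u : nat -> C) (l : C) :
  u @ \oo --> l -> (fun n => modulus (u n)) @ \oo --> modulus l.
Proof.
move=> /cvg_modulusP ul; apply/cvgrPdistC_lt => e e0; near=> n.
rewrite (le_lt_trans (le_modulus_dist _ _))//.
have : `|modulus (u n - l)| < e by near: n; move/cvgr0_norm_lt : ul; apply.
by rewrite ger0_norm ?modulus_ge0.
Unshelve. all: by end_near. Qed.

Lemma ccvgD (u v : nat -> C) (l m : C) :
  u @ \oo --> l -> v @ \oo --> m -> (fun n => u n + v n) @ \oo --> l + m.
Proof.
move=> /cvg_modulusP ul /cvg_modulusP vm.
have h : (fun n => modulus (u n - l) + modulus (v n - m)) @ \oo --> (0:R).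
  by rewrite -[X in _ --> X]addr0; exact: cvgD.
apply: (cvg_modulus_le _ h); near=> n.
by rewrite opprD addrACA modulusD.
Unshelve. all: by end_near. Qed.

Lemma ccvgZ (u : nat -> C) (k l : C) :
  u @ \oo --> l -> (fun n => k * u n) @ \oo --> k * l.
Proof.
move=> /cvg_modulusP ul.
have h : (fun n => modulus k * modulus (u n - l)) @ \oo --> (0:R).
  by rewrite -[X in _ --> X](mulr0 (modulus k)); apply: cvgM => //; exact: cvg_cst.
apply: (cvg_modulus_le _ h); near=> n.
by rewrite -mulrBr modulusM.
Unshelve. all: by end_near. Qed.

Lemma ccvg_sum (u : nat -> nat -> C) (l : nat -> C) (J : nat) :
  (forall j, u j @ \oo --> l j) ->
  (fun n => \sum_(0 <= j < J) u j n) @ \oo --> \sum_(0 <= j < J) l j.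
Proof.
move=> ul; elim: J => [|J IH].
  rewrite (big_geq (leqnn 0)) (_ : (fun n => _) = fun=> 0); first exact: ccvg_cst.
  by apply/funext => n; rewrite big_geq.
have E (F : nat -> C) : \sum_(0 <= j < J.+1) F j = \sum_(0 <= j < J) F j + F J.
  by rewrite big_nat_recr.
rewrite E; under eq_fun do rewrite E.
exact: ccvgD IH (ul J).
Qed.

Lemma modulus_lim_le (u : nat -> C) (l : C) (B : R) :
  u @ \oo --> l -> (forall n, modulus (u n) <= B) -> modulus l <= B.
Proof.
move=> /ccvg_modulus ul uB; apply: (cvgr_to_le ul).
by near=> n.
Unshelve. all: by end_near. Qed.

(** Absolute summability is carried together with an explicit bound, since the
    exponential of a series sums infinitely many such bounds. *)
Definition abs_bound (x : nat -> C) (B : R) :=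
  forall N, \sum_(0 <= n < N) modulus (x n) <= B.

Lemma abs_bound_ge0 (x : nat -> C) (B : R) : abs_bound x B -> 0 <= B.
Proof. by move=> /(_ 0%N); rewrite big_geq. Qed.

Lemma bounded_cvg_series (x : nat -> R) (B : R) :
  (forall N, \sum_(0 <= n < N) `|x n| <= B) -> cvgn (series x).
Proof.
move=> xB; apply: normed_cvg; apply: nondecreasing_is_cvgn.
  by apply: nondecreasing_series => n _ _; exact: normr_ge0.
by exists B => _ [n _ <-]; exact: xB.
Qed.

Lemma Re_sum (I : Type) (r : seq I) (F : I -> C) :
  complex.Re (\sum_(i <- r) F i) = \sum_(i <- r) complex.Re (F i).
Proof. by elim/big_rec2 : _ => // i a [b d] _ <-; case: (F i). Qed.

Lemma Im_sum (I : Type) (r : seq I) (F : I -> C) :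
  complex.Im (\sum_(i <- r) F i) = \sum_(i <- r) complex.Im (F i).
Proof. by elim/big_rec2 : _ => // i a [b d] _ <-; case: (F i). Qed.

Lemma cvg_ReIm (u : nat -> C) (a b : R) :
  (fun n => complex.Re (u n)) @ \oo --> a -> (fun n => complex.Im (u n)) @ \oo --> b ->
  u @ \oo --> (Complex a b : C).
Proof.
move=> ua ub.
have ua' : (fun n => `|complex.Re (u n) - a|) @ \oo --> (0:R).
  by rewrite -(normr0 R) -(subrr a); apply: cvg_norm; apply: cvgB => //; exact: cvg_cst.
have ub' : (fun n => `|complex.Im (u n) - b|) @ \oo --> (0:R).
  by rewrite -(normr0 R) -(subrr b); apply: cvg_norm; apply: cvgB => //; exact: cvg_cst.
have h : (fun n => `|complex.Re (u n) - a| + `|complex.Im (u n) - b|) @ \oo --> (0:R).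
  by rewrite -[X in _ --> X]addr0; exact: cvgD.
apply: (cvg_modulus_le _ h); near=> n.
by rewrite (le_trans (modulus_le_ReIm _))//; case: (u n).
Unshelve. all: by end_near. Qed.

(** Completeness of the complex numbers, in the form used for Dirichlet series:
    real and imaginary parts of the terms are dominated by their moduli. *)
Lemma abs_bound_cvg (x : nat -> C) (B : R) :
  abs_bound x B -> series x @ \oo --> limn (series x).
Proof.
move=> xB.
have /cvg_ex[a ha] : cvgn (series (fun n => complex.Re (x n))).
  apply: (@bounded_cvg_series _ B) => N; rewrite (le_trans _ (xB N))//.
  by apply: ler_sum => n _; exact: Re_le_modulus.
have /cvg_ex[b hb] : cvgn (series (fun n => complex.Im (x n))).
  apply: (@bounded_cvg_series _ B) => N; rewrite (le_trans _ (xB N))//.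
  by apply: ler_sum => n _; exact: Im_le_modulus.
have h : series x @ \oo --> (Complex a b : C).
  apply: cvg_ReIm.
  - by under eq_fun do rewrite /series/= Re_sum.
  - by under eq_fun do rewrite /series/= Im_sum.
by rewrite (ccvg_lim h).
Qed.

Lemma abs_bound_lim_le (x : nat -> C) (B : R) (l : C) :
  abs_bound x B -> series x @ \oo --> l -> modulus l <= B.
Proof.
move=> xB xl; apply: (modulus_lim_le xl) => n.
by rewrite (le_trans (modulus_sum _ _ _)).
Qed.

(** Exchange of two summations for an absolutely summable double sequence [x]:
    [f] collects the sums of the rows and [d] those of the columns. *)
Section IteratedSeries.
Variables (x : nat -> nat -> C) (B : nat -> R) (M : R) (f d : nat -> C).
Hypothesis xB : forall j, abs_bound (x j) (B j).
Hypothesis BM : forall J, \sum_(0 <= j < J) B j <= M.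
Hypothesis xf : forall j, series (x j) @ \oo --> f j.
Hypothesis xd : forall m, series (fun j => x j m) @ \oo --> d m.

Lemma iterated_series_bound : abs_bound d M.
Proof.
move=> N.
have h : (fun J => \sum_(0 <= m < N) modulus (\sum_(0 <= j < J) x j m)) @ \oo
   --> \sum_(0 <= m < N) modulus (d m).
  elim: N => [|N IH].
    rewrite big_geq// (_ : (fun J => _) = fun=> 0); first exact: cvg_cst.
    by apply/funext => J; rewrite big_geq.
  rewrite big_nat_recr//= (_ : (fun J => _) =
      fun J => \sum_(0 <= m < N) modulus (\sum_(0 <= j < J) x j m) +
               modulus (\sum_(0 <= j < J) x j N)).
    by apply: cvgD => //; exact: ccvg_modulus (@xd N).
  by apply/funext => J; rewrite big_nat_recr.
apply: (cvgr_to_le h); near=> J.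
apply: le_trans (BM J).
rewrite (@le_trans _ _ (\sum_(0 <= m < N) \sum_(0 <= j < J) modulus (x j m)))//.
  by apply: ler_sum => m _; exact: modulus_sum.
by rewrite exchange_big/=; apply: ler_sum => j _; exact: xB.
Unshelve. all: by end_near. Qed.

(** Dominated convergence: outside finitely many rows [j < J] the double sum is
    bounded by the tail of the series of [B], uniformly in the number of columns
    taken, and on the remaining rows the partial sums converge. *)
Lemma iterated_series_swap (L : C) : series f @ \oo --> L -> series d @ \oo --> L.
Proof.
move=> fL.
have B0 j : 0 <= B j := abs_bound_ge0 (xB j).
have cB : cvgn (series B).
  by apply: (@bounded_cvg_series _ M) => N; under eq_bigr do rewrite ger0_norm//;
    exact: BM.
(* Rows [J] to [J'] contribute at most the corresponding bounds, whatever [N]. *)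
have Bnd J J' : (J <= J')%N -> forall N,
    modulus (\sum_(0 <= m < N) \sum_(0 <= j < J') x j m -
             \sum_(0 <= m < N) \sum_(0 <= j < J) x j m) <= series B J' - series B J.
  move=> JJ' N.
  rewrite -sumrB.
  rewrite (_ : \sum_(0 <= i < N) _ = \sum_(J <= j < J') \sum_(0 <= m < N) x j m).
    rewrite sub_series_geq// (le_trans (modulus_sum _ _ _))//.
    apply: ler_sum => j _; rewrite (le_trans (modulus_sum _ _ _))//; exact: xB.
  rewrite exchange_big/=; apply: eq_bigr => m _.
  by rewrite (@big_cat_nat _ _ _ J 0 J')//= addrAC subrr add0r.
(* [J'] to infinity in the previous bound. *)
have dS J N : modulus (\sum_(0 <= m < N) d m - \sum_(0 <= m < N) \sum_(0 <= j < J) x j m)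
   <= limn (series B) - series B J.
  have h1 : (fun J' => \sum_(0 <= m < N) \sum_(0 <= j < J') x j m) @ \oo -->
    \sum_(0 <= m < N) d m.
    by apply: (@ccvg_sum (fun m J' => \sum_(0 <= j < J') x j m) d N) => m; exact: xd.
  have h2 := ccvg_modulus (ccvgD h1 (@ccvg_cst (- \sum_(0 <= m < N) \sum_(0 <= j < J) x j m))).
  apply: (ler_cvg_to h2 (cvgB cB (cvg_cst (series B J)))).
  by near=> J'; apply: Bnd; near: J'; exact: nbhs_infty_ge.
apply/cvg_modulusP/cvgr0Pnorm_lt => e e0.
have e4 : 0 < e / 4 by lra.
have [J [h1 h2]] : exists J, limn (series B) - series B J < e / 4 /\
    modulus (series f J - L) < e / 4.
  near \oo => J; exists J; split; last first.
    rewrite -[X in X < _]ger0_norm ?modulus_ge0//.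
    near: J; move/cvg_modulusP/cvgr0_norm_lt : fL; exact.
  rewrite (le_lt_trans (ler_norm _))//.
  near: J; move/cvgrPdist_lt : cB; exact.
have h3 : (fun N => \sum_(0 <= j < J) series (x j) N) @ \oo --> \sum_(0 <= j < J) f j.
  by apply: (@ccvg_sum (fun j N => series (x j) N) f J) => j; exact: xf.
near=> N.
rewrite ger0_norm ?modulus_ge0//.
have h4 : modulus (\sum_(0 <= j < J) series (x j) N - series f J) < e / 4.
  rewrite -[X in X < _]ger0_norm ?modulus_ge0//.
  by near: N; move/cvg_modulusP/cvgr0_norm_lt : h3; exact.
have h5 := dS J N.
have -> : series d N - L = (series d N - \sum_(0 <= m < N) \sum_(0 <= j < J) x j m) +
   ((\sum_(0 <= j < J) series (x j) N - series f J) + (series f J - L)).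
  rewrite exchange_big /=; rewrite /series/=; ring.
rewrite (le_lt_trans (modulusD _ _))//.
have := modulusD (\sum_(0 <= j < J) series (x j) N - series f J) (series f J - L).
move: h1 h2 h4 h5; rewrite /series/=; lra.
Unshelve. all: by end_near. Qed.
End IteratedSeries.

End Modulus.

(** * The complex exponential series *)

Section Exponential.
Variable R : realType.
Notation C := (R[i]^o).

Lemma ccvg_near_cst (u : nat -> C) (l : C) :
  (\forall n \near \oo, u n = l) -> u @ \oo --> l.
Proof.
move=> ul; apply: (@cvg_modulus_le _ _ _ (fun=> 0)); last exact: cvg_cst.
by apply: filterS ul => n ->; rewrite subrr modulus0.
Qed.

Lemma modulusX (z : C) n : modulus (z ^+ n) = modulus z ^+ n.
Proof. by elim: n => [|n IH]; rewrite ?expr0 ?modulus1// !exprS modulusM IH. Qed.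

Lemma modulus_cexp (z : C) : modulus (cexp z) = expR (complex.Re z).
Proof.
by rewrite modulusE /= !exprMn -mulrDr cos2Dsin2 mulr1 sqrtr_sqr ger0_norm// expR_ge0.
Qed.

Lemma cexpD (z w : C) : cexp (z + w) = cexp z * cexp w.
Proof.
case: z => a b; case: w => a' b'.
apply/eqP; rewrite eq_complex /= expRD cosD sinD; apply/andP; split; apply/eqP; ring.
Qed.

Lemma cexp0 : cexp (0 : C) = 1.
Proof. by rewrite /cexp /= expR0 cos0 sin0 mulr1 mulr0. Qed.

Lemma mulrn_real (t : C) (n : nat) : t *+ n = (n%:R : R)%:C%C * t.
Proof.
elim: n => [|n IH]; first by rewrite mulr0n mul0r.
by rewrite mulrS IH -[in RHS]natr1 rmorphD/= mulrDl mul1r addrC.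
Qed.

Definition exp_term (z : C) (j : nat) : C := ((j`!%:R : R)^-1)%:C%C * z ^+ j.

Lemma modulus_exp_term (z : C) j : modulus (exp_term z j) = exp_coeff (modulus z) j.
Proof.
by rewrite /exp_term modulusM modulusX modulus_real ger0_norm ?invr_ge0// mulrC.
Qed.

Lemma sum_exp_coeff_le (r : R) J : 0 <= r -> \sum_(0 <= j < J) exp_coeff r j <= expR r.
Proof.
move=> r0; apply: (@nondecreasing_cvgn_le _ (series (exp_coeff r))).
  by apply: nondecreasing_series => n _ _; rewrite divr_ge0// exprn_ge0.
exact: is_cvg_series_exp_coeff.
Qed.

Lemma exp_term_bound (z : C) : abs_bound (exp_term z) (expR (modulus z)).
Proof.
move=> N; under eq_bigr do rewrite modulus_exp_term.
exact: sum_exp_coeff_le (modulus_ge0 z).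
Qed.

Lemma exp_term_real (x : R) : series (exp_term x%:C%C) @ \oo --> ((expR x)%:C%C : C).
Proof.
have E n : exp_term x%:C%C n = (exp_coeff x n)%:C%C.
  rewrite /exp_term /exp_coeff /= mulrC rmorphM/=; congr (_ * _).
  by elim: n => [|n IH]; rewrite ?expr0// !exprS IH rmorphM.
apply: cvg_ReIm.
  rewrite (_ : (fun n => _) = series (exp_coeff x));
    first exact: is_cvg_series_exp_coeff.
  by apply/funext => n; rewrite /series/= Re_sum; apply: eq_bigr => i _; rewrite E.
rewrite (_ : (fun n => _) = fun=> 0); first exact: cvg_cst.
by apply/funext => n; rewrite /series/= Im_sum big1// => i _; rewrite E.
Qed.

Lemma exp_term_imag (y : R) : series (exp_term (Complex 0 y)) @ \oo -->
  (Complex (cos y) (sin y) : C).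
Proof.
have P n : (Complex 0 y : C) ^+ n = Complex ((~~ odd n)%:R * (-1) ^+ n./2 * y ^+ n)
    ((odd n)%:R * (-1) ^+ n.-1./2 * y ^+ n).
  elim: n => [|n IH]; first by rewrite expr0 /= !mul1r !mul0r.
  rewrite exprSr IH /= exprSr; case: (boolP (odd n)) => on /=.
    have -> : (uphalf n = n.-1./2.+1)%N by case: n on {IH}.
    by apply/eqP; rewrite eq_complex /= exprS; apply/andP; split; apply/eqP; ring.
  have -> : (uphalf n = n./2)%N by rewrite uphalf_half (negbTE on).
  by apply/eqP; rewrite eq_complex /=; apply/andP; split; apply/eqP; ring.
have E n : exp_term (Complex 0 y) n = Complex (cos_coeff y n) (sin_coeff y n).
  rewrite /exp_term P /=; apply/eqP; rewrite eq_complex /cos_coeff /sin_coeff/=.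
    by apply/andP; split; apply/eqP; rewrite -?exprnP; ring.
apply: cvg_ReIm.
  rewrite (_ : (fun n => _) = series (cos_coeff y)).
    rewrite cos.unlock; exact: is_cvg_series_cos_coeff.
  by apply/funext => n; rewrite /series/= Re_sum; apply: eq_bigr => i _; rewrite E.
rewrite (_ : (fun n => _) = series (sin_coeff y)).
  rewrite sin.unlock; exact: is_cvg_series_sin_coeff.
by apply/funext => n; rewrite /series/= Im_sum; apply: eq_bigr => i _; rewrite E.
Qed.

Lemma sum_shift (V : nmodType) (g : nat -> V) j N :
  \sum_(0 <= m < N) (if (j <= m)%N then g (m - j)%N else 0) =
  \sum_(0 <= m < N - j) g m.
Proof.
have [jN|Nj] := leqP j N; last first.
  rewrite [RHS]big_geq; last by rewrite leqn0 subn_eq0 ltnW.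
  rewrite big_nat big1// => m /andP[_ mN].
  by rewrite leqNgt (ltn_trans mN Nj).
rewrite (@big_cat_nat _ _ _ j)//= [X in X + _]big_nat [X in X + _]big1 ?add0r.
  rewrite -{1}[j]add0n big_addn; apply: eq_bigr => m _.
  by rewrite leq_addl addnK.
by move=> m /andP[_ mj]; rewrite leqNgt mj.
Qed.

(** The Cauchy product, as an exchange of summations: row [j] of the array is
    the [j]-th term for [z] times the series for [w] shifted by [j], and column
    [m] is the binomial expansion of the [m]-th term for [z + w]. *)
Lemma exp_term_add (z w a b : C) :
  series (exp_term z) @ \oo --> a -> series (exp_term w) @ \oo --> b ->
  series (exp_term (z + w)) @ \oo --> a * b.
Proof.
move=> za wb.
pose x j m := if (j <= m)%N then exp_term z j * exp_term w (m - j)%N else 0.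
pose B j := modulus (exp_term z j) * expR (modulus w).
apply: (@iterated_series_swap _ x B (expR (modulus z) * expR (modulus w))
   (fun j => exp_term z j * b)).
- move=> j N; rewrite (_ : \sum_(0 <= n < N) _ =
  \sum_(0 <= n < (N - j)%N) modulus (exp_term z j * exp_term w n)).
    under eq_bigr do rewrite modulusM.
    by rewrite -mulr_sumr ler_wpM2l ?modulus_ge0//; exact: exp_term_bound.
  rewrite -sum_shift; apply: eq_bigr => m _; rewrite /x; case: ifP => //.
  by rewrite modulus0.
- move=> J; rewrite -mulr_suml ler_wpM2r ?expR_ge0//; exact: exp_term_bound.
- move=> j; rewrite (_ : series (x j) = fun N =>
  exp_term z j * series (exp_term w) (N - j)%N).
    by apply: ccvgZ; rewrite (@cvg_centern _ C).
  apply/funext => N; rewrite /series/= mulr_sumr -sum_shift; apply: eq_bigr => m _.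
  by rewrite /x; case: ifP.
- move=> m; apply: ccvg_near_cst; near=> J.
  have mJ : (m.+1 <= J)%N by near: J; exact: nbhs_infty_ge.
  rewrite /series/= (@big_cat_nat _ _ _ m.+1)//= [X in _ + X]big_nat [X in _ +
    X]big1 ?addr0; last first.
    by move=> j /andP[mj _]; rewrite /x leqNgt mj.
  rewrite /exp_term addrC exprDn big_mkord mulr_sumr; apply: eq_bigr => i _.
  rewrite /x /exp_term -ltnS ltn_ord.
  have im : (i <= m)%N by rewrite -ltnS.
  rewrite mulrn_real.
  have -> : ('C(m,i)%:R : R) = m`!%:R * (i`!%:R^-1 * (m - i)`!%:R^-1).
    apply: (@mulIf _ (i`! * (m - i)`!)%:R);
      first by rewrite pnatr_eq0 -lt0n muln_gt0 !fact_gt0.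
    rewrite -natrM bin_fact// natrM; field; rewrite !pnatr_eq0 -!lt0n !fact_gt0//.
  rewrite !rmorphM/=.
  have E : (((m`!%:R)^-1 : R)%:C%C : C) * (m`!%:R : R)%:C%C = 1.
    by rewrite -rmorphM mulVf// pnatr_eq0 -lt0n fact_gt0.
  rewrite -2!mulrA (mulrA _ (m`!%:R : R)%:C%C) E; ring.
- rewrite (_ : series _ = fun J => b * series (exp_term z) J).
    by rewrite (mulrC a b); exact: (@ccvgZ _ _ b _ za).
  by apply/funext => J; rewrite /series/= -mulr_suml mulrC.
Unshelve. all: by end_near. Qed.

(** [cexp] is defined by real exponential, cosine and sine; splitting z into its
    real and imaginary parts reduces its power series to theirs. *)
Lemma exp_term_cvg (z : C) : series (exp_term z) @ \oo --> cexp z.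
Proof.
case: z => x y.
have -> : Complex x y = (x%:C%C : C) + Complex 0 y.
  by apply/eqP; rewrite eq_complex /= addr0 add0r !eqxx.
rewrite cexpD; apply: exp_term_add.
  by rewrite /cexp/= cos0 sin0 mulr1 mulr0; exact: exp_term_real.
by rewrite /cexp/= expR0 !mul1r; exact: exp_term_imag.
Qed.

End Exponential.

(** * Algebra of absolutely convergent Dirichlet series *)

Section DirichletAlgebra.
Variable R : realType.
Notation C := (R[i]^o).

(** The real power n^{-sigma}, which is the modulus of n^{-s} for Re s = sigma. *)
Definition npowR (n : nat) (sigma : R) : R := expR (- (sigma * ln n%:R)).

Lemma npowR_gt0 n sigma : 0 < npowR n sigma.
Proof. exact: expR_gt0. Qed.

Lemma npowR_ge0 n sigma : 0 <= npowR n sigma.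
Proof. exact: expR_ge0. Qed.

Lemma npowR_le1 n sigma : (0 < n)%N -> 0 <= sigma -> npowR n sigma <= 1.
Proof.
move=> n0 s0; rewrite /npowR expR_le1 oppr_le0 mulr_ge0// ln_ge0//.
by rewrite ler1n.
Qed.

Lemma npowRD n a b : npowR n (a + b) = npowR n a * npowR n b.
Proof. by rewrite /npowR -expRD mulrDl opprD. Qed.

Lemma npowRM m n a : (0 < m)%N -> (0 < n)%N -> npowR (m * n) a = npowR m a * npowR n a.
Proof.
move=> m0 n0; rewrite /npowR -expRD natrM lnM ?posrE ?ltr0n//.
by rewrite mulrDr opprD.
Qed.

Lemma npowR_lt1 n sigma : (1 < n)%N -> 0 < sigma -> npowR n sigma < 1.
Proof. by move=> n1 s0; rewrite /npowR expR_lt1 oppr_lt0 mulr_gt0// ln_gt0// ltr1n. Qed.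

Lemma le_npowR n a b : (0 < n)%N -> a <= b -> npowR n b <= npowR n a.
Proof.
by move=> n0 ab; rewrite /npowR ler_expR lerN2 ler_wpM2r// ln_ge0// ler1n.
Qed.

Lemma npowR1 a : npowR 1 a = 1.
Proof. by rewrite /npowR ln1 mulr0 oppr0 expR0. Qed.

Lemma modulus_npow n (s : C) : modulus (npow n s) = npowR n (complex.Re s).
Proof. by rewrite /npow modulus_cexp; case: s => a b /=; rewrite mulr0 subr0. Qed.

Lemma npow1 (s : C) : npow 1 s = 1.
Proof. by rewrite /npow ln1 mulr0 oppr0 cexp0. Qed.

Lemma npowM m n (s : C) : (0 < m)%N -> (0 < n)%N ->
  npow (m * n) s = npow m s * npow n s.
Proof.
move=> m0 n0; rewrite /npow -cexpD natrM lnM ?posrE ?ltr0n//.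
by rewrite rmorphD/= mulrDr opprD.
Qed.

Lemma npowD n (s t : C) : npow n (s + t) = npow n s * npow n t.
Proof. by rewrite /npow -cexpD mulrDl opprD. Qed.

Lemma npowX n k (s : C) : (0 < n)%N -> npow (n ^ k) s = npow n (k%:R * s).
Proof.
move=> n0; elim: k => [|k IH];
  first by rewrite expn0 npow1 mul0r /npow mul0r oppr0 cexp0.
by rewrite expnS npowM ?expn_gt0 ?n0// IH -natr1 mulrDl mul1r npowD mulrC.
Qed.

(** Dirichlet series start at index 1 and [series] at index 0. *)
Definition dterm (d : nat -> C) (s : C) (n : nat) : C := d n.+1 * npow n.+1 s.

Lemma dirichlet_partialE d N (s : C) : dirichlet_partial d N s = series (dterm d s) N.
Proof. by rewrite /dirichlet_partial big_add1. Qed.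

(** Both data refer to a single point s, while the coefficients d do not: a
    sequence d represents a function on a half-plane when it represents its
    value at each point, with a bound that may depend on the point. *)
Definition represents (d : nat -> C) (s : C) (B : R) (F : C) :=
  abs_bound (dterm d s) B /\ series (dterm d s) @ \oo --> F.

Definition dconv (d e : nat -> C) (m : nat) : C :=
  \sum_(1 <= k < m.+1 | (k %| m)%N) d k * e (m %/ k)%N.

(** In the array whose rows are the products of one term of [d] with the series
    of [e], row [k] lives on the multiples of [k + 1]. *)
Lemma sum_multiples (V : nmodType) (g : nat -> V) k N :
  \sum_(0 <= m < N) (if (k.+1 %| m.+1)%N then g (m.+1 %/ k.+1).-1 else 0) =
  \sum_(0 <= j < N %/ k.+1) g j.
Proof.
elim: N => [|N IH]; first by rewrite div0n !big_geq.
rewrite big_nat_recr//= IH (divnS N)//; case: ifP => h; rewrite ?add0n ?addr0//.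
by rewrite h !add1n big_nat_recr.
Qed.

Lemma cvg_divn k : (fun N => (N %/ k.+1)%N) @ \oo --> \oo.
Proof.
move=> A [M _ MA]; exists (M * k.+1)%N => // n /= h; apply: MA => /=.
by rewrite leq_divRL.
Qed.

(** Row [k] of the array below is the [k]-th term of [d] times the series of
    [e], moved to the multiples of [k + 1]; its columns are finite and add up to
    the Dirichlet convolution. *)
Lemma represents_conv d e (s : C) B B' F G :
  represents d s B F -> represents e s B' G ->
  represents (dconv d e) s (B * B') (F * G).
Proof.
move=> [dB dF] [eB eG].
pose x k m := if (k.+1 %| m.+1)%N
  then dterm d s k * dterm e s (m.+1 %/ k.+1).-1 else 0.
pose b k := modulus (dterm d s k) * B'.
have B'0 := abs_bound_ge0 eB.
have H1 k : abs_bound (x k) (b k).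
  move=> N; rewrite (_ : \sum_(0 <= n < N) _ =
      \sum_(0 <= j < (N %/ k.+1)%N) modulus (dterm d s k * dterm e s j)).
    under eq_bigr do rewrite modulusM.
    by rewrite -mulr_sumr ler_wpM2l ?modulus_ge0//; exact: eB.
  rewrite -(sum_multiples (fun j => modulus (dterm d s k * dterm e s j))).
  by apply: eq_bigr => m _; rewrite /x; case: ifP => //; rewrite modulus0.
have H2 J : \sum_(0 <= j < J) b j <= B * B'.
  by rewrite -mulr_suml ler_wpM2r//; exact: dB.
have H3 k : series (x k) @ \oo --> dterm d s k * G.
  rewrite (_ : series (x k) = fun N => dterm d s k * (series (dterm e s) \o (fun N =>
    N %/ k.+1)%N) N).
    by apply: (@ccvgZ _ _ _ G); apply: (cvg_comp _ _ (@cvg_divn k) eG).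
  apply/funext => N; rewrite /series/= mulr_sumr.
  rewrite -(sum_multiples (fun j => dterm d s k * dterm e s j)).
  by apply: eq_bigr.
have H4 m : series (x^~ m) @ \oo --> dterm (dconv d e) s m.
  apply: ccvg_near_cst; near=> J.
  have mJ : (m.+1 <= J)%N by near: J; exact: nbhs_infty_ge.
  rewrite /series/= (@big_cat_nat _ _ _ m.+1)//= [X in _ + X]big_nat [X in _ +
    X]big1 ?addr0; last first.
    move=> j /andP[mj _]; rewrite /x; case: ifP => // /dvdn_leq => /(_ isT).
    by rewrite ltnS leqNgt mj.
  rewrite /dterm /dconv mulr_suml big_add1/= [RHS]big_mkcond/=; apply: eq_bigr => k _.
  rewrite /x; case: ifP => // km; rewrite /dterm.
  have mk : (0 < m.+1 %/ k.+1)%N by rewrite divn_gt0// dvdn_leq.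
  rewrite (prednK mk).
  have -> : npow m.+1 s = npow (m.+1 %/ k.+1) s * npow k.+1 s.
    by rewrite -npowM// divnK.
  ring.
split; first exact: (iterated_series_bound H1 H2 H4).
apply: (iterated_series_swap H1 H2 H3 H4).
rewrite (_ : series _ = fun J => G * series (dterm d s) J).
  by rewrite (mulrC F G); exact: (@ccvgZ _ _ G _ dF).
by apply/funext => J; rewrite /series/= -mulr_suml mulrC.
Unshelve. all: by end_near. Qed.

Definition ddelta (k : nat) (n : nat) : C := if n == k then 1 else 0.

Lemma represents_delta k (s : C) : (0 < k)%N ->
  represents (ddelta k) s (npowR k (complex.Re s)) (npow k s).
Proof.
case: k => // k _.
have E (V : nmodType) (f : nat -> V) N : (forall n, (n != k)%N -> f n = 0) ->
   \sum_(0 <= n < N) f n = if (k < N)%N then f k else 0.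
  move=> f0; elim: N => [|N IH]; first by rewrite big_geq.
  rewrite big_nat_recr//= IH ltnS.
  case: (ltngtP k N) => kN /=; last by rewrite add0r kN.
    by rewrite (f0 N) ?addr0// gtn_eqF.
  by rewrite add0r f0// ltn_eqF.
have Ek : dterm (ddelta k.+1) s k = npow k.+1 s.
  by rewrite /dterm /ddelta eqxx mul1r.
have E0 n : (n != k)%N -> dterm (ddelta k.+1) s n = 0.
  by move=> nk; rewrite /dterm /ddelta eqSS (negbTE nk) mul0r.
split.
  move=> N; rewrite (E _ (fun n => modulus (dterm (ddelta k.+1) s n))).
    by case: ifP => _; rewrite ?npowR_ge0// Ek modulus_npow.
  by move=> n nk; rewrite E0// modulus0.
apply: ccvg_near_cst; near=> N.
have kN : (k < N)%N by near: N; exact: nbhs_infty_ge.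
by rewrite /series/= E// kN Ek.
Unshelve. all: by end_near. Qed.

Lemma represents_add d e (s : C) B B' F G :
  represents d s B F -> represents e s B' G ->
  represents (fun n => d n + e n) s (B + B') (F + G).
Proof.
move=> [dB dF] [eB eG]; split.
  move=> N; apply: le_trans (lerD (dB N) (eB N)).
  rewrite -big_split/=; apply: ler_sum => n _.
  by rewrite /dterm mulrDl modulusD.
rewrite (_ : series _ = fun N => series (dterm d s) N + series (dterm e s) N).
  exact: (ccvgD dF eG).
by apply/funext => N; rewrite /series/= -big_split/=; apply: eq_bigr => n _;
  rewrite /dterm mulrDl.
Qed.

Lemma represents_scale d (s : C) (k : C) B F :
  represents d s B F -> represents (fun n => k * d n) s (modulus k * B) (k * F).
Proof.
move=> [dB dF]; split.
  move=> N; apply: le_trans (ler_wpM2l (modulus_ge0 k) (dB N)).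
  rewrite mulr_sumr; apply: ler_sum => n _.
  by rewrite /dterm -mulrA modulusM.
rewrite (_ : series _ = fun N => k * series (dterm d s) N).
  exact: (@ccvgZ _ _ k _ dF).
by apply/funext => N; rewrite /series/= mulr_sumr; apply: eq_bigr => n _;
  rewrite /dterm mulrA.
Qed.

Fixpoint dpow (d : nat -> C) (j : nat) : nat -> C :=
  if j is j'.+1 then dconv d (dpow d j') else ddelta 1.

Lemma represents_pow d (s : C) B F j :
  represents d s B F -> represents (dpow d j) s (B ^+ j) (F ^+ j).
Proof.
move=> dF; elim: j => [|j IH].
  by have := @represents_delta 1 s isT; rewrite npow1 npowR1 !expr0.
by rewrite !exprS; exact: represents_conv.
Qed.

Definition dexp (x : C) (d : nat -> C) (m : nat) : C :=
  limn (series (fun j => exp_term x j * dpow d j m)).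

(** The array has the Dirichlet series of (x F)^j / j! as its [j]-th row.  The
    bound for row [j] is the [j]-th term of the exponential series of
    [modulus x * B], which makes the array absolutely summable. *)
Lemma represents_exp d (s : C) (x : C) B F :
  represents d s B F ->
  represents (dexp x d) s (expR (modulus x * B)) (cexp (x * F)).
Proof.
move=> dF.
have B0 : 0 <= B := abs_bound_ge0 dF.1.
have H j := represents_scale (exp_term x j) (represents_pow j dF).
pose y j m := dterm (fun n => exp_term x j * dpow d j n) s m.
have H1 j : abs_bound (y j) (modulus (exp_term x j) * B ^+ j) := (H j).1.
have Ec j : modulus (exp_term x j) * B ^+ j = exp_coeff (modulus x * B) j.
  by rewrite modulus_exp_term /exp_coeff /= exprMn mulrAC.
have H2 J : \sum_(0 <= j < J) (modulus (exp_term x j) * B ^+ j) <= expR (modulus x * B).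
  under eq_bigr do rewrite Ec.
  by apply: sum_exp_coeff_le; rewrite mulr_ge0// modulus_ge0.
have H3 j : series (y j) @ \oo --> exp_term x j * F ^+ j := (H j).2.
(* Dividing by the power recovers the convergence of the coefficients
   themselves, which do not depend on s, from that of the terms at s. *)
have npow_inv m : npow m.+1 s * cexp (s * (ln (m.+1%:R : R))%:C%C) = 1.
  by rewrite /npow -cexpD addNr cexp0.
have H4 m : series (y^~ m) @ \oo --> dterm (dexp x d) s m.
  have yb N : \sum_(0 <= j < N) modulus (y j m) <= expR (modulus x * B).
    apply: le_trans (H2 N); apply: ler_sum => j _.
    apply: le_trans (H1 j m.+1).
    rewrite big_nat_recr//= lerDr sumr_ge0// => i _; exact: modulus_ge0.
  have cy := abs_bound_cvg yb.
  have -> : series (y^~ m) = fun N => npow m.+1 s * series (fun j =>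
    exp_term x j * dpow d j m.+1) N.
    by apply/funext => N; rewrite /series/= mulr_sumr; apply: eq_bigr => j _;
      rewrite mulrC.
  rewrite /dterm mulrC; apply: ccvgZ.
  rewrite /dexp.
  have cc : series (fun j => exp_term x j * dpow d j m.+1) @ \oo -->
     cexp (s * (ln (m.+1%:R : R))%:C%C) * limn (series (y^~ m)).
    have -> : series (fun j => exp_term x j * dpow d j m.+1) =
       fun N => cexp (s * (ln (m.+1%:R : R))%:C%C) * series (y^~ m) N.
      apply/funext => N; rewrite /series/= mulr_sumr; apply: eq_bigr => j _.
      by rewrite /y /dterm [RHS]mulrC -[RHS]mulrA npow_inv mulr1.
    exact: (@ccvgZ _ _ _ _ cy).
  by rewrite (ccvg_lim cc).
split; first exact: (iterated_series_bound H1 H2 H4).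
apply: (iterated_series_swap H1 H2 H3 H4).
rewrite (_ : (fun j => exp_term x j * F ^+ j) = exp_term (x * F));
  first exact: exp_term_cvg.
by apply/funext => j; rewrite /exp_term exprMn_comm ?mulrA//; exact: mulrC.
Qed.

End DirichletAlgebra.

(** * Smooth supports and uniqueness of coefficients *)

Section Smooth.
Variable R : realType.
Notation C := (R[i]^o).

Lemma max_pdivM_le (y m n : nat) : (0 < m)%N -> (0 < n)%N ->
  (max_pdiv m <= y)%N -> (max_pdiv n <= y)%N -> (max_pdiv (m * n) <= y)%N.
Proof.
move=> m0 n0 my ny.
have [mn1|mn1] := leqP (m * n) 1.
  have -> : (m * n)%N = 1%N by apply/eqP; rewrite eqn_leq mn1 muln_gt0 m0.
  exact: leq_trans (max_pdiv_gt0 m) my.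
have pp := max_pdiv_prime mn1.
have := max_pdiv_dvd (m * n); rewrite Euclid_dvdM// => /orP[pm|pn].
  by apply: leq_trans my; apply: max_pdiv_max; rewrite inE/= mem_primes pp m0.
by apply: leq_trans ny; apply: max_pdiv_max; rewrite inE/= mem_primes pp n0.
Qed.

Lemma max_pdiv_dvd_le (m n : nat) : (0 < n)%N -> (m %| n)%N ->
  (max_pdiv m <= max_pdiv n)%N.
Proof.
move=> n0 mn; have [m1|m1] := leqP m 1.
  by rewrite (leq_trans (max_pdiv_leq _))// ?(leq_trans m1)//; exact: dvdn_gt0 mn.
apply: max_pdiv_max; rewrite inE/= mem_primes max_pdiv_prime// n0.
exact: dvdn_trans (max_pdiv_dvd m) mn.
Qed.

(** Smoothness is measured by a bound [y] on the prime divisors. *)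
Definition smooth_support (y : nat) (d : nat -> C) :=
  forall n, (0 < n)%N -> (y < max_pdiv n)%N -> d n = 0.

Lemma smooth_support_conv y d e :
  smooth_support y d -> smooth_support y e -> smooth_support y (dconv d e).
Proof.
move=> dy ey m m0 ym; rewrite /dconv big_nat_cond big1// => k /andP[/andP[k0 km] dvd].
have mk0 : (0 < m %/ k)%N by rewrite divn_gt0// dvdn_leq.
have [yk|ky] := ltnP y (max_pdiv k); first by rewrite dy ?mul0r.
have [yk|ky'] := ltnP y (max_pdiv (m %/ k)); first by rewrite ey ?mulr0.
by move: ym; rewrite -(divnK dvd) ltnNge max_pdivM_le.
Qed.

Lemma smooth_support_delta y k : (0 < k)%N -> (max_pdiv k <= y)%N ->
  smooth_support y (ddelta R k).
Proof.
move=> k0 ky n n0 yn; rewrite /ddelta; case: eqP => // nk.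
by move: yn; rewrite nk ltnNge ky.
Qed.

Lemma smooth_support_pow y d j : (0 < y)%N -> smooth_support y d ->
  smooth_support y (dpow d j).
Proof.
move=> y0 dy; elim: j => [|j IH] /=; first exact: smooth_support_delta.
exact: smooth_support_conv.
Qed.

Lemma smooth_support_exp y d x : (0 < y)%N -> smooth_support y d ->
  smooth_support y (dexp x d).
Proof.
move=> y0 dy m m0 ym; rewrite /dexp; apply: ccvg_lim; apply: ccvg_near_cst.
near=> N; rewrite /series/= big1// => j _.
by rewrite (smooth_support_pow _ y0 dy)// mulr0.
Unshelve. all: by end_near. Qed.

(** The convergence of the partial Euler product, by induction on [y].  With
    p = y + 2, a p-smooth n which p does not divide is (p - 1)-smooth, and the
    multiples of p contribute at most p^{-sigma} times the whole sum S, so that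
    S <= Z + p^{-sigma} S. *)
Lemma smooth_sum_bounded (y : nat) (sigma : R) : 0 < sigma ->
  exists Z, forall N, \sum_(1 <= n < N.+1 | (max_pdiv n <= y)%N) npowR n sigma <= Z.
Proof.
move=> s0; elim: y => [|[|y] [Z IH]].
- exists 0 => N; rewrite big_nat_cond big1// => n /andP[_].
  by rewrite leqNgt max_pdiv_gt0.
- exists 1 => -[|N]; first by rewrite big_geq.
  rewrite big_ltn_cond// npowR1 /= big_nat_cond big1 ?addr0// => n /andP[/andP[n1 _]].
  by rewrite leqNgt prime_gt1 ?max_pdiv_prime.
- pose p := y.+2; pose q : R := npowR p sigma.
  have q1 : q < 1 by exact: npowR_lt1.
  exists (Z / (1 - q)) => N; rewrite ler_pdivlMr ?subr_gt0// mulrBr mulr1 lerBlDr.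
  apply: (@le_trans _ _ (\sum_(1 <= n < N.+1 | (max_pdiv n <= y.+1)%N) npowR n sigma +
      \sum_(1 <= n < N.+1 | (max_pdiv n <= p)%N && (p %| n)%N) npowR n sigma));
        last first.
    apply: lerD (IH N) _; rewrite big_add1/= big_mkcond/=.
    pose g j : R := if (max_pdiv j.+1 <= p)%N then npowR j.+1 sigma * q else 0.
    have g0 j : 0 <= g j by rewrite /g; case: ifP => // _; rewrite mulr_ge0// npowR_ge0.
    apply: (@le_trans _ _ (\sum_(0 <= m < N) (if (p %| m.+1)%N then g (m.+1 %/ p).-1 else 0))).
      apply: ler_sum => m _; case: ifP => [/andP[sm pm]|_]; last by case: ifP.
      have m0 : (0 < m.+1 %/ p)%N by rewrite divn_gt0// dvdn_leq.
      rewrite pm /g (prednK m0) (leq_trans _ sm) ?max_pdiv_dvd_le ?dvdn_div//.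
      by rewrite -npowRM// divnK.
    rewrite (sum_multiples g y.+1) mulr_suml [leRHS]big_add1/= [leRHS]big_mkcond/=.
    rewrite [leRHS](@big_cat_nat _ _ _ (N %/ y.+2))//= ?leq_div// lerDl.
    apply: sumr_ge0 => j _; exact: g0.
  rewrite [leLHS]big_mkcond [X in _ <= X + _]big_mkcond [X in _ <= _ +
    X]big_mkcond addrC -big_split/=.
  rewrite big_nat [leRHS]big_nat; apply: ler_sum => n /andP[n0 _].
  case: ifP => [np|_] /=; last by rewrite add0r; case: ifP => // _; exact: npowR_ge0.
  have [pn|pn] := boolP (p %| n)%N; first by rewrite lerDl; case: ifP => // _;
    exact: npowR_ge0.
  rewrite add0r ifT// -ltnS ltn_neqAle np andbT.
  by apply: contraNneq pn => np'; rewrite /p -np'; exact: max_pdiv_dvd.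
Qed.

Lemma represents_sub d e (s : C) B B' F G :
  represents d s B F -> represents e s B' G ->
  exists B'', represents (fun n => d n - e n) s B'' (F - G).
Proof.
move=> dF /(represents_scale (-1)) eG; eexists.
have := represents_add dF eG; rewrite mulN1r.
by under [X in represents X]eq_fun do rewrite mulN1r; apply.
Qed.

(** The classical argument: if g vanishes below the index n, then multiplying the
    series by n^t and letting t tend to infinity through the reals isolates
    g n, as the ratio ((n + 1) / n)^{-t} of the next terms tends to 0. *)
Lemma dirichlet_unique0 (g : nat -> C) :
  (forall t : R, 2 <= t -> exists B, represents g t%:C%C B 0) ->
  forall n, (0 < n)%N -> g n = 0.
Proof.
move=> H.
have [B [gB _]] := H 2 (lexx _).
have B0 := abs_bound_ge0 gB.
have pos (t : R) N : modulus (dterm g t%:C%C N) = modulus (g N.+1) * npowR N.+1 t.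
  by rewrite /dterm modulusM modulus_npow.
suff : forall m, g m.+1 = 0 by move=> h [].
elim/ltn_ind => m IH.
pose r : R := npowR m.+2 1 / npowR m.+1 1.
have r0 : 0 <= r by rewrite divr_ge0// npowR_ge0.
have r1 : r < 1.
  rewrite /r ltr_pdivrMr ?npowR_gt0// mul1r /npowR !mul1r ltr_expR ltrN2.
  by rewrite ltr_ln ?posrE ?ltr0n// ltr_nat.
have npowRX n j : npowR n (j%:R : R) = npowR n 1 ^+ j.
  by rewrite /npowR mul1r -expRM_natl mulrN.
(* At t = 2 + j the series sums to 0, and its terms beyond m are at most
   (m + 2)^{-j} times those at t = 2. *)
have key j : modulus (g m.+1) * npowR m.+1 2 <= B * r ^+ j.
  rewrite /r expr_div_n -!npowRX mulrA ler_pdivlMr ?npowR_gt0// -mulrA -npowRD -pos.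
  set t := (2 + j%:R)%:C%C.
  have [B' [_ /ccvg_modulus gt]] : exists B, represents g t B 0.
    by apply: H; rewrite lerDl.
  rewrite modulus0 in gt.
  have h : (fun N => modulus (series (dterm g t) N) +
    B * npowR m.+2 (j%:R : R)) @ \oo --> 0 + B * npowR m.+2 (j%:R : R).
    by apply: cvgD; [exact: gt|exact: cvg_cst].
  rewrite add0r in h; apply: (cvgr_to_ge h); near=> N.
  have mN : (m < N)%N by near: N; exact: nbhs_infty_gt.
  have -> : dterm g t m = series (dterm g t) N - \sum_(m.+1 <= k < N) dterm g t k.
    rewrite /series/= (@big_cat_nat _ _ _ m.+1)//= addrK big_nat_recr//=
      big_nat big1 ?add0r//.
    by move=> i /andP[_ im]; rewrite /dterm IH// mul0r.
  apply: le_trans (modulusD _ _) _; rewrite modulusN lerD2l.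
  apply: le_trans (modulus_sum _ _ _) _.
  apply: (@le_trans _ _ (\sum_(m.+1 <= k < N) modulus (dterm g 2%:C%C k) * npowR m.+2 j%:R)).
    rewrite big_nat [leRHS]big_nat; apply: ler_sum => k /andP[mk _].
    rewrite !pos npowRD -mulrA ler_wpM2l ?modulus_ge0// ler_wpM2l ?npowR_ge0//.
    rewrite /npowR ler_expR lerN2 ler_wpM2l// ler_ln ?posrE ?ltr0n// ler_nat.
    by rewrite ltnS.
  rewrite -mulr_suml ler_wpM2r ?npowR_ge0//.
  apply: le_trans (gB N); rewrite [leRHS](@big_cat_nat _ _ _ m.+1)//=
    lerDr sumr_ge0// => i _.
  exact: modulus_ge0.
have : modulus (g m.+1) * npowR m.+1 2 <= 0.
  have h : (fun j => B * r ^+ j) @ \oo --> B * 0.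
    by apply: cvgM; [exact: cvg_cst|apply: cvg_expr; rewrite ger0_norm].
  rewrite mulr0 in h; apply: (cvgr_to_ge h); near=> j; exact: key.
rewrite pmulr_lle0 ?npowR_gt0// => g0.
by apply: modulus_eq0; apply/eqP; rewrite eq_le g0 modulus_ge0.
Unshelve. all: by end_near. Qed.

(** * Composition of Dirichlet polynomials with a symbol *)

Section Symbol.
Variables (c0 : nat) (Phi : C -> C) (c : nat -> C) (y : nat).
Hypothesis hPhi : c0_symbol c0 Phi c.
Hypothesis y0 : (0 < y)%N.
Hypothesis cy : smooth_support y c.

Lemma symbol_cvg (s : C) : 0 < complex.Re s ->
  series (dterm c s) @ \oo --> Phi s - c0%:R * s.
Proof.
move=> s0; have h : 0 < complex.Re s / 2 by rewrite divr_gt0.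
have := symbol_series hPhi h.
have sub : [set s] `<=` halfplane (complex.Re s / 2).
  by move=> _ ->; rewrite /halfplane/= ltr_pdivrMr// ltr_pMr// ltr1n.
move=> /(uniform_subset_cvg _ sub); rewrite uniform_set1.
rewrite (_ : series (dterm c s) = (fun g : C -> C => g s) \o dirichlet_partial c) //.
by apply/funext => N /=; rewrite dirichlet_partialE.
Qed.

(** Convergence at a point t > 0 bounds the terms c_n n^{-t}; taking t = Re s / 2
    leaves a factor n^{-t}, which is summable over the smooth n. *)
Lemma symbol_represents (s : C) : 0 < complex.Re s ->
  exists B, represents c s B (Phi s - c0%:R * s).
Proof.
move=> s0; pose t := complex.Re s / 2.
have t0 : 0 < t by rewrite divr_gt0.
(* The terms of a convergent series are bounded. *)
have [M hM] : exists M, forall N, modulus (c N.+1) * npowR N.+1 t <= M.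
  have ct := @symbol_cvg t%:C%C t0.
  have cm := ccvg_modulus ct.
  have /cvg_seq_bounded bd : cvgn (fun N => modulus (series (dterm c t%:C%C) N)).
    by apply/cvg_ex; eexists; exact: cm.
  have [M hM] : exists M, forall N, modulus (series (dterm c t%:C%C) N) <= M.
    case: bd => M [_ /(_ (M + 1)) bM]; exists (M + 1) => N.
    by apply: le_trans (ler_norm _) _; apply: bM => //; rewrite ltrDl.
  exists (M + M) => N.
  rewrite (_ : _ * _ = modulus (dterm c t%:C%C N));
    last by rewrite /dterm modulusM modulus_npow.
  have -> : dterm c t%:C%C N = series (dterm c t%:C%C) N.+1 - series (dterm c t%:C%C) N.
    by rewrite /series/= big_nat_recr//= addrAC subrr add0r.
  by apply: le_trans (modulusD _ _) _; rewrite modulusN lerD.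
have [Z hZ] := smooth_sum_bounded y t0.
have M0 : 0 <= M by apply: le_trans (hM 0%N); rewrite mulr_ge0 ?modulus_ge0 ?npowR_ge0.
exists (M * Z); split; last exact: symbol_cvg.
move=> N; apply: le_trans (ler_wpM2l M0 (hZ N)).
rewrite [in leRHS]big_add1/= [in leRHS]big_mkcond/= mulr_sumr; apply: ler_sum => n _.
case: ifP => [ny|/negbT]; last first.
  by rewrite -ltnNge => ny; rewrite /dterm cy// mul0r modulus0 mulr0.
rewrite /dterm modulusM modulus_npow (_ : complex.Re s = t + t);
  last by rewrite /t -splitr.
by rewrite npowRD mulrA ler_wpM2r ?npowR_ge0.
Unshelve. all: by end_near. Qed.

(** The coefficients of n^{-Phi(s)}, from the factorisation of the latter as
    (n^{c0})^{-s} exp(- phi(s) log n). *)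
Definition comp_coef (n : nat) : nat -> C :=
  dconv (ddelta R (n ^ c0)) (dexp ((- ln (n%:R : R))%:C%C) c).

Lemma represents_npow_symbol n (s : C) : (0 < n)%N -> 0 < complex.Re s ->
  exists B, represents (comp_coef n) s B (npow n (Phi s)).
Proof.
move=> n0 s0; have [B hB] := symbol_represents s0.
have h := represents_exp (- ln (n%:R : R))%:C%C hB.
have nc : (0 < n ^ c0)%N by rewrite expn_gt0 n0.
have := represents_conv (represents_delta s nc) h => hh.
eexists; rewrite (_ : npow n (Phi s) =
  npow (n ^ c0) s * cexp ((- ln (n%:R : R))%:C%C * (Phi s - c0%:R * s))).
  exact: hh.
rewrite npowX// -{1}(subrK (c0%:R * s) (Phi s)) npowD mulrC; congr (_ * _).
by rewrite /npow rmorphN/= mulNr mulrC.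
Qed.

Lemma smooth_support_comp n : (0 < n)%N -> (max_pdiv n <= y)%N ->
  smooth_support y (comp_coef n).
Proof.
move=> n0 ny; apply: smooth_support_conv; last exact: smooth_support_exp.
apply: smooth_support_delta; first by rewrite expn_gt0 n0.
elim: c0 => [|k IH]; first by rewrite expn0.
by rewrite expnS; apply: max_pdivM_le => //; rewrite expn_gt0 n0.
Qed.

(** The sum over n is finite, so that no convergence in n has to be checked: for
    an infinite [a] the moduli of the double series need not be summable when
    Re s is small. *)
Lemma represents_poly_symbol (a : nat -> C) N : smooth_support y a ->
  exists d, smooth_support y d /\ forall s : C, 0 < complex.Re s ->
    exists B, represents d s B (\sum_(1 <= n < N.+1) a n * npow n (Phi s)).
Proof.
move=> ay; elim: N => [|N [d [dy dr]]].
  exists (fun=> 0); split => // s s0; exists 0; rewrite big_geq//.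
  split.
    by move=> M; rewrite big1// => n _; rewrite /dterm mul0r modulus0.
  apply: ccvg_near_cst; near=> M.
  by rewrite /series/= big1// => n _; rewrite /dterm mul0r.
exists (fun m => d m + a N.+1 * comp_coef N.+1 m); split.
  move=> n n0 yn; rewrite dy// add0r.
  have [yN|Ny] := ltnP y (max_pdiv N.+1); first by rewrite ay// mul0r.
  by rewrite smooth_support_comp// mulr0.
move=> s s0; have [B hB] := dr s s0.
have [B' hB'] := @represents_npow_symbol N.+1 s isT s0.
have hh := represents_add hB (represents_scale (a N.+1) hB').
have -> : \sum_(1 <= n < N.+2) a n * npow n (Phi s) =
  \sum_(1 <= n < N.+1) a n * npow n (Phi s) + a N.+1 * npow N.+1 (Phi s).
  by rewrite big_nat_recr.
by eexists; exact: hh.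
Unshelve. all: by end_near. Qed.

End Symbol.
End Smooth.

(** * Weights and norms *)

Section Weights.
Variable R : realType.
Notation C := (R[i]^o).
Notation mu := (@lebesgue_measure R).

Definition weight_integral (h : R -> R) (n : nat) : \bar R :=
  (\int[mu]_(x in `]0%R, +oo[) (n%:R `^ (- (2 * x)) * h x)%:E)%E.

Lemma powR_npowR n (x : R) : (0 < n)%N -> n%:R `^ (- (2 * x)) = npowR n (2 * x).
Proof. by move=> n0; rewrite /powR pnatr_eq0 gtn_eqF// /npowR mulNr. Qed.

Section AdmissibleDensity.
Variable h : R -> R.
Hypothesis ah : admissible_density h.

Lemma measurable_weight n : measurable_fun (`]0%R, +oo[ : set R)
  (fun x => (n%:R `^ (- (2 * x)) * h x)%:E).
Proof.
apply/measurable_EFinP; apply: measurable_funM; last exact: density_measurable.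
apply: (measurableT_comp (measurable_powRr n%:R)).
apply: measurableT_comp => //; exact: measurable_funM.
Qed.

Lemma measurable_density : measurable_fun (`]0%R, +oo[ : set R) (fun x => (h x)%:E).
Proof. by apply/measurable_EFinP; exact: density_measurable. Qed.

Lemma weight_integral_ge0 n : (0 <= weight_integral h n)%E.
Proof.
apply: integral_ge0 => x /=; rewrite in_itv/= andbT => x0.
by rewrite lee_fin mulr_ge0 ?powR_ge0// density_ge0.
Qed.

Lemma weight_integral_le1 n : (0 < n)%N -> (weight_integral h n <= 1)%E.
Proof.
move=> n0; rewrite -(density_mass1 ah) /density_measure setTI.
apply: ge0_le_integral => //.
- move=> x /=; rewrite in_itv/= andbT => x0.
  by rewrite lee_fin mulr_ge0 ?powR_ge0// density_ge0.
- exact: measurable_weight.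
- exact: measurable_density.
- move=> x /=; rewrite in_itv/= andbT => x0; rewrite lee_fin powR_npowR//.
  by rewrite ler_piMl ?density_ge0// npowR_le1// mulr_ge0// ltW.
Qed.

Lemma weightE n : (0 < n)%N -> (weight h n)%:E = weight_integral h n.
Proof.
move=> n0; rewrite /weight /Rintegral fineK//.
by rewrite ge0_fin_numE ?weight_integral_ge0// (le_lt_trans (weight_integral_le1 n0))// ltry.
Qed.

Lemma weight_le1 n : (0 < n)%N -> weight h n <= 1.
Proof. by move=> n0; rewrite -lee_fin weightE// weight_integral_le1. Qed.

(** As 0 lies in the support of the measure, ]0, eps / 2[ has positive mass k,
    and n^{- 2 x} is at least n^{- eps} there. *)
Lemma weight_lower (eps : R) : 0 < eps ->
  exists2 k : R, 0 < k & forall n, (0 < n)%N -> k * npowR n eps <= weight h n.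
Proof.
move=> e0; pose U : set R := `](- (eps / 2)), (eps / 2)[%classic.
have U0 : U 0 by rewrite /U/= in_itv/= oppr_lt0 divr_gt0.
have oU : open U by exact: interval_open.
have pos := density_supp0 ah oU U0.
have mD : measurable (U `&` `]0%R, +oo[ : set R) by apply: measurableI;
  exact: measurable_itv.
have le1 : (density_measure h U <= 1)%E.
  rewrite -(density_mass1 ah) /density_measure setTI.
  apply: ge0_subset_integral => //; [exact: measurable_density|].
  by move=> x /=; rewrite in_itv/= andbT => x0; rewrite lee_fin density_ge0.
have fin : density_measure h U \is a fin_num.
  by rewrite ge0_fin_numE ?(le_lt_trans le1) ?ltry// ltW// pos.
exists (fine (density_measure h U));
  first by rewrite fine_gt0// pos (le_lt_trans le1)// ltry.
move=> n n0; rewrite -lee_fin weightE// EFinM fineK// muleC.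
apply: (@le_trans _ _ (\int[mu]_(x in U `&` `]0%R, +oo[) (n%:R `^ (- (2 * x)) * h x)%:E)%E); last first.
  apply: ge0_subset_integral => //; first exact: measurable_weight.
  move=> x /=; rewrite in_itv/= andbT => x0.
  by rewrite lee_fin mulr_ge0 ?powR_ge0// density_ge0.
rewrite /density_measure -ge0_integralZl_EFin ?npowR_ge0//; last 2 first.
- by move=> x /= [_]; rewrite in_itv/= andbT => x0; rewrite lee_fin density_ge0.
- by apply: measurable_funS measurable_density.
apply: ge0_le_integral => //.
- move=> x /= [_]; rewrite in_itv/= andbT => x0.
  by rewrite -EFinM lee_fin mulr_ge0 ?npowR_ge0// density_ge0.
- by apply: measurable_funeM; apply: measurable_funS measurable_density.
- by apply: measurable_funS (measurable_weight n).
- move=> x /= []; rewrite /U/= !in_itv/= andbT => /andP[_ xe] x0.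
  rewrite -EFinM lee_fin ler_wpM2r ?density_ge0// powR_npowR//.
  by apply: le_npowR => //; rewrite mulrC -ler_pdivlMr// ltW.
Qed.

Lemma weight_gt0 n : (0 < n)%N -> 0 < weight h n.
Proof.
move=> n0; have [k k0 /(_ n n0)] := weight_lower ltr01.
by apply: lt_le_trans; rewrite mulr_gt0// npowR_gt0.
Qed.

Definition A2_term (a : nat -> C) n := modulus (a n) ^+ 2 * weight h n.

Lemma A2_term_ge0 a n : (0 < n)%N -> 0 <= A2_term a n.
Proof. by move=> n0; rewrite mulr_ge0 ?sqr_ge0// ltW// weight_gt0. Qed.

Lemma A2_sqnorm_ge0 a : (0 <= A2_sqnorm h a)%E.
Proof. by apply: nneseries_ge0 => n n0 _; rewrite lee_fin A2_term_ge0. Qed.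

Lemma A2_norm_ge0 a : 0 <= A2_norm h a.
Proof. exact: sqrtr_ge0. Qed.

Lemma sum_A2_le a N : A2 h a -> \sum_(1 <= n < N) A2_term a n <= A2_norm h a ^+ 2.
Proof.
move=> aA; rewrite /A2_norm sqr_sqrtr ?fine_ge0 ?A2_sqnorm_ge0//.
rewrite -lee_fin fineK; last by rewrite ge0_fin_numE ?A2_sqnorm_ge0.
rewrite -sumEFin; apply: nneseries_lim_ge => n n0 _.
by rewrite lee_fin A2_term_ge0.
Qed.

(** With [sum_A2_le], this replaces [A2_norm], the square root of the real part
    of an extended real series, by bounds on finite sums. *)
Lemma A2_bound a B : (forall N, \sum_(1 <= n < N.+1) A2_term a n <= B) ->
  A2 h a /\ A2_norm h a ^+ 2 <= B.
Proof.
move=> aB.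
have le : (A2_sqnorm h a <= B%:E)%E.
  apply: lime_le.
    by apply: is_cvg_nneseries => n n0 _; rewrite lee_fin A2_term_ge0.
  apply: nearW => -[|N]; rewrite sumEFin lee_fin; last exact: aB.
  by rewrite big_geq//; apply: le_trans (aB 0%N); rewrite big_geq.
have fin : (A2_sqnorm h a < +oo)%E by rewrite (le_lt_trans le)// ltry.
split => //; rewrite /A2_norm sqr_sqrtr ?fine_ge0 ?A2_sqnorm_ge0//.
by rewrite -lee_fin fineK// ge0_fin_numE ?A2_sqnorm_ge0.
Qed.

Lemma A2_sub a b : A2 h a -> A2 h b -> A2 h (fun n => a n - b n).
Proof.
move=> aA bA.
apply: (proj1 (@A2_bound _ (2 * A2_norm h a ^+ 2 + 2 * A2_norm h b ^+ 2) _)) => N.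
apply: (@le_trans _ _ (2 * (\sum_(1 <= n < N.+1) A2_term a n) +
    2 * (\sum_(1 <= n < N.+1) A2_term b n))); last first.
  by apply: lerD; rewrite ler_wpM2l// sum_A2_le.
rewrite !mulr_sumr -big_split/= big_nat [leRHS]big_nat; apply: ler_sum => n /andP[n0 _].
rewrite /A2_term 2!(mulrA 2) -mulrDl; apply: ler_wpM2r;
  first by rewrite ltW// weight_gt0.
have h1 := modulusD (a n) (- b n); rewrite modulusN in h1.
have h2 : modulus (a n - b n) ^+ 2 <= (modulus (a n) + modulus (b n)) ^+ 2.
  by rewrite lerXn2r ?nnegrE ?addr_ge0 ?modulus_ge0.
have := sqr_ge0 (modulus (a n) - modulus (b n)).
move: h2; rewrite sqrrD sqrrB => h2 h3 /=; lra.
Qed.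

End AdmissibleDensity.

(** The discriminant of the nonnegative quadratic polynomial with value
    sum of (x_i t - y_i)^2 at t. *)
Lemma cauchy_schwarz_sum (I : Type) (r : seq I) (P : pred I) (x y : I -> R) :
  (\sum_(i <- r | P i) x i * y i) ^+ 2 <=
  (\sum_(i <- r | P i) x i ^+ 2) * (\sum_(i <- r | P i) y i ^+ 2).
Proof.
set A := \sum_(i <- r | P i) x i ^+ 2; set B := \sum_(i <- r | P i) y i ^+ 2.
set S := \sum_(i <- r | P i) x i * y i.
have A0 : 0 <= A by apply: sumr_ge0 => i _; exact: sqr_ge0.
have B0 : 0 <= B by apply: sumr_ge0 => i _; exact: sqr_ge0.
have Q t : 0 <= A * t ^+ 2 - 2 * S * t + B.
  have -> : A * t ^+ 2 - 2 * S * t + B = \sum_(i <- r | P i) (x i * t - y i) ^+ 2.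
    rewrite /A /B /S mulr_suml mulr_sumr mulr_suml -sumrB -big_split/=.
    by apply: eq_bigr => i _; ring.
  by apply: sumr_ge0 => i _; exact: sqr_ge0.
have [A00|] := eqVneq A 0.
  have [->|S0] := eqVneq S 0; first by rewrite expr0n/= mulr_ge0.
  have := Q ((B + 1) / (2 * S)); rewrite A00 mul0r sub0r mulrC divfK ?mulf_neq0//.
  lra.
move=> An; have Ap : 0 < A by rewrite lt_neqAle eq_sym An.
have := Q (S / A).
have -> : A * (S / A) ^+ 2 - 2 * S * (S / A) + B = (A * B - S ^+ 2) / A by field.
by rewrite pmulr_lge0 ?invr_gt0// subr_ge0.
Qed.

End Weights.

(** * Partial reproducing kernels *)

Lemma next_prime_gt m : prime (next_prime m) && (m < next_prime m)%N.
Proof. by rewrite /next_prime; case: ex_minnP. Qed.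

Lemma nth_prime_ge l : (l <= nth_prime l)%N.
Proof.
elim: l => // l IH; have /andP[_] := next_prime_gt (nth_prime l).
exact: leq_ltn_trans.
Qed.

Lemma nth_prime_ge2 l : (0 < l)%N -> (2 <= nth_prime l)%N.
Proof.
case: l => // l _; have /andP[+ _] := next_prime_gt (nth_prime l).
exact: prime_gt1.
Qed.

Section Kernel.
Variable R : realType.
Notation C := (R[i]^o).
Variable h : R -> R.
Hypothesis ah : admissible_density h.

Lemma npow_real n (t : R) : npow n (t%:C%C : C) = (npowR n t)%:C%C.
Proof.
apply/eqP; rewrite eq_complex /npow /cexp /=.
by rewrite !mulr0 mul0r subr0 addr0 oppr0 cos0 sin0 mulr1 mulr0 !eqxx.
Qed.

Lemma npowR2 n (sigma : R) : npowR n (2 * sigma) = npowR n sigma ^+ 2.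
Proof. by rewrite /npowR -expRM_natl; congr expR; ring. Qed.

Lemma modulusV (z : C) : modulus (z^-1) = (modulus z)^-1.
Proof. by apply: (@complexI R); rewrite fmorphV /= !modulusC;
  exact: (normfV (z : R[i])). Qed.

(** The Cauchy-Schwarz inequality for |a_n| sqrt(w_n) and n^{-sigma} / sqrt(w_n). *)
Lemma A2_schwarz a (sigma : R) (P : pred nat) N Z : A2 h a ->
  \sum_(1 <= n < N.+1 | P n) npowR n (2 * sigma) / weight h n <= Z ->
  (\sum_(1 <= n < N.+1 | P n) modulus (a n) * npowR n sigma) ^+ 2 <= A2_norm h a ^+ 2 * Z.
Proof.
move=> aA hZ.
pose x n := modulus (a n) * Num.sqrt (weight h n).
pose y n := npowR n sigma / Num.sqrt (weight h n).
have w0 n : (0 < n)%N -> Num.sqrt (weight h n) != 0.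
  by move=> n0; rewrite gt_eqF// sqrtr_gt0 weight_gt0.
have -> : \sum_(1 <= n < N.+1 | P n) modulus (a n) * npowR n sigma =
          \sum_(1 <= n < N.+1 | P n) x n * y n.
  rewrite big_nat_cond [RHS]big_nat_cond; apply: eq_bigr => n /andP[/andP[n0 _] _].
  by rewrite /x /y; field; exact: w0.
apply: le_trans (cauchy_schwarz_sum _ _ _ _) _.
apply: ler_pM.
- by apply: sumr_ge0 => n _; exact: sqr_ge0.
- by apply: sumr_ge0 => n _; exact: sqr_ge0.
- apply: le_trans (sum_A2_le ah N.+1 aA).
  rewrite [leRHS](bigID P)/= -[leLHS]addr0; apply: lerD; last first.
    by rewrite big_nat_cond; apply: sumr_ge0 => n /andP[/andP[n0 _] _];
      exact: A2_term_ge0.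
  rewrite big_nat_cond [leRHS]big_nat_cond; apply: ler_sum => n /andP[/andP[n0 _] _].
  by rewrite /x exprMn sqr_sqrtr// ltW// weight_gt0.
- apply: le_trans hZ.
  rewrite big_nat_cond [leRHS]big_nat_cond; apply: ler_sum => n /andP[/andP[n0 _] _].
  rewrite /y exprMn exprVn sqr_sqrtr; last by rewrite ltW// weight_gt0.
  by rewrite npowR2.
Qed.

Lemma sum_inv_sqr_le N : \sum_(1 <= n < N.+1) npowR n (2 : R) <= 2.
Proof.
have E n : (0 < n)%N -> npowR n (2 : R) = (n%:R ^+ 2)^-1.
  move=> n0; rewrite /npowR expRN expRM_natl lnK// posrE ltr0n//.
suff S : \sum_(1 <= n < N.+2) npowR n (2 : R) <= 2 - N.+1%:R^-1.
  case: N S => [|N] S; first by rewrite big_geq.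
  apply: (@le_trans _ _ (\sum_(1 <= n < N.+3) npowR n (2 : R))).
    by rewrite [leRHS]big_nat_recr//= lerDl npowR_ge0.
  by apply: le_trans S _; rewrite gerBl invr_ge0.
elim: N => [|N IH]; first by rewrite big_nat1 npowR1 invr1; lra.
rewrite big_nat_recr//=; apply: le_trans (lerD IH (lexx _)) _.
rewrite E// -lerBrDl.
have a0 : 0 < N.+1%:R :> R by rewrite ltr0n.
have -> : N.+2%:R = N.+1%:R + 1 :> R by rewrite -natr1.
move: (N.+1%:R : R) a0 => x x0.
have -> : 2 - (x + 1)^-1 - (2 - x^-1) = (x * (x + 1))^-1.
  by field; rewrite ?gt_eqF//; lra.
rewrite lef_pV2 ?posrE ?exprn_gt0 ?mulr_gt0//; [|lra..].
nra.
Qed.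

(** Uniqueness of coefficients only looks far to the right, so a crude bound
    suffices: n^{-4} / w_n is dominated by n^{-2}, since w_n is at least a
    multiple of n^{-1}. *)
Lemma A2_abs_bound b (t : R) : A2 h b -> 2 <= t ->
  exists B, abs_bound (dterm b t%:C%C) B.
Proof.
move=> bA t2; have [k k0 hk] := weight_lower ah ltr01.
exists (Num.sqrt (A2_norm h b ^+ 2 * (2 / k))) => N.
rewrite -[leLHS]ger0_norm; last by apply: sumr_ge0 => n _; exact: modulus_ge0.
rewrite -sqrtr_sqr ler_sqrt; last first.
  by rewrite mulr_ge0 ?sqr_ge0// divr_ge0// ltW.
have -> : \sum_(0 <= n < N) modulus (dterm b t%:C%C n) =
    \sum_(1 <= n < N.+1 | xpredT n) modulus (b n) * npowR n t.
  by rewrite big_add1/=; apply: eq_bigr => n _; rewrite /dterm modulusM modulus_npow.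
apply: A2_schwarz => //.
apply: (@le_trans _ _ (\sum_(1 <= n < N.+1) npowR n (2 : R) / k)); last first.
  by rewrite -mulr_suml ler_wpM2r ?sum_inv_sqr_le// invr_ge0 ltW.
rewrite big_nat [leRHS]big_nat; apply: ler_sum => n /andP[n0 _].
rewrite ler_pdivrMr ?weight_gt0//.
apply: (@le_trans _ _ (npowR n 2 / k * (k * npowR n 1))).
  rewrite mulrA divfK ?gt_eqF// -npowRD; apply: le_npowR => //; lra.
by rewrite ler_wpM2l ?hk// divr_ge0 ?npowR_ge0// ltW.
Qed.

Variable l : nat.
Hypothesis l0 : (0 < l)%N.
Let y := nth_prime l.
Let y2 : (2 <= y)%N := nth_prime_ge2 l0.

Definition kernel_term (sigma : R) (n : nat) : R :=
  if (max_pdiv n <= nth_prime l)%N then npowR n (2 * sigma) / weight h n else 0.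

Lemma kernel_term_ge0 sigma n : (0 < n)%N -> 0 <= kernel_term sigma n.
Proof.
move=> n0; rewrite /kernel_term; case: ifP => // _.
by rewrite divr_ge0 ?npowR_ge0// ltW// weight_gt0.
Qed.

Lemma modulus_partial_kernel (s : C) n : (0 < n)%N ->
  modulus (partial_kernel h l s n) ^+ 2 * weight h n = kernel_term (complex.Re s) n.
Proof.
move=> n0; rewrite /partial_kernel /kernel_term; case: ifP => _; last first.
  by rewrite modulus0 expr0n mul0r.
rewrite modulusM modulusV modulus_real ger0_norm ?ltW ?weight_gt0//.
rewrite modulus_npow (_ : complex.Re (s^*)%C = complex.Re s); last by case: s.
rewrite npowR2; field.
by rewrite gt_eqF// weight_gt0.
Qed.

Lemma sum_A2_term_kernel (s : C) N :
  \sum_(1 <= n < N) A2_term h (partial_kernel h l s) n =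
  \sum_(1 <= n < N) kernel_term (complex.Re s) n.
Proof.
rewrite big_nat [RHS]big_nat; apply: eq_bigr => n /andP[n0 _].
exact: modulus_partial_kernel.
Qed.

Lemma kernel_A2 (s : C) : 0 < complex.Re s -> A2 h (partial_kernel h l s).
Proof.
move=> s0; have [k k0 hk] := weight_lower ah s0.
have [Z hZ] := smooth_sum_bounded y s0.
apply: (proj1 (@A2_bound _ _ ah _ (Z / k) _)) => N.
rewrite sum_A2_term_kernel; apply: le_trans (ler_wpM2r _ (hZ N));
  last by rewrite invr_ge0 ltW.
rewrite [in leRHS]big_mkcond mulr_suml big_nat [leRHS]big_nat; apply: ler_sum =>
  n /andP[n0 _].
rewrite /kernel_term -/y; case: ifP => _; last by rewrite mul0r.
rewrite npowR2 expr2 ler_pdivrMr ?weight_gt0// -mulrA ler_wpM2l ?npowR_ge0//.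
by rewrite mulrC ler_pdivlMr// mulrC hk.
Qed.

Definition kernel_norm (s : C) := A2_norm h (partial_kernel h l s).

Lemma sum_kernel_term_le (s : C) N : 0 < complex.Re s ->
  \sum_(1 <= n < N) kernel_term (complex.Re s) n <= kernel_norm s ^+ 2.
Proof. by move=> s0; rewrite -sum_A2_term_kernel sum_A2_le//; exact: kernel_A2. Qed.

Lemma kernel_norm_sqr_le (s : C) B :
  (forall N, \sum_(1 <= n < N.+1) kernel_term (complex.Re s) n <= B) ->
  kernel_norm s ^+ 2 <= B.
Proof. by move=> sB; apply: (proj2 (A2_bound ah _)) => N;
  rewrite sum_A2_term_kernel. Qed.

Lemma kernel_norm_ge1 (s : C) : 0 < complex.Re s -> 1 <= kernel_norm s.
Proof.
move=> s0; have := sum_kernel_term_le 2 s0; rewrite big_nat1 => hk.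
rewrite -(@ler_pXn2r _ 2) ?nnegrE ?A2_norm_ge0// expr1n; apply: le_trans hk.
rewrite /kernel_term (leq_trans _ y2)// npowR1 ler_pdivlMr ?weight_gt0// mul1r.
exact: weight_le1.
Qed.

(** The partial kernel represents evaluation on smoothly supported sequences; the
    bound holds for the sum of the moduli. *)
Lemma A2_smooth_sum_le a (s : C) N : A2 h a -> 0 < complex.Re s ->
  \sum_(1 <= n < N.+1 | (max_pdiv n <= nth_prime l)%N) modulus (a n) * npowR n (complex.Re s)
  <= A2_norm h a * kernel_norm s.
Proof.
move=> aA s0.
rewrite -(@ler_pXn2r _ 2) ?nnegrE ?mulr_ge0 ?A2_norm_ge0//; last first.
  by apply: sumr_ge0 => n _; rewrite mulr_ge0 ?modulus_ge0 ?npowR_ge0.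
rewrite exprMn; apply: A2_schwarz => //.
apply: le_trans (sum_kernel_term_le N.+1 s0).
by rewrite big_mkcond.
Qed.

(** The weights are at most 1, so each power of 2 contributes 2^{- 2 j sigma} at
    least; for sigma < 1 / (2 (J + 1)) the powers 2^j with j <= J contribute at
    least 1 / 2 each. *)
Lemma kernel_norm_unbounded B : exists2 theta : R, 0 < theta &
  forall s : C, 0 < complex.Re s < theta -> B <= kernel_norm s.
Proof.
have [J hJ] : exists J : nat, 2 * B ^+ 2 <= J.+1%:R.
  exists (Num.truncn (2 * B ^+ 2)); exact/ltW/truncnS_gt.
exists ((2 * J.+1%:R)^-1); first by rewrite invr_gt0 mulr_gt0.
move=> s /andP[s0 sJ].
have [B0|B0] := leP B 0; first by apply: le_trans B0 _; exact: A2_norm_ge0.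
rewrite -(@ler_pXn2r _ 2) ?nnegrE ?A2_norm_ge0// ?(ltW B0)//.
apply: le_trans (sum_kernel_term_le (2 ^ J.+1) s0).
have T j : (j <= J)%N -> 2^-1 <= kernel_term (complex.Re s) (2 ^ j).
  move=> jJ; have p0 : (0 < 2 ^ j)%N by rewrite expn_gt0.
  rewrite /kernel_term ifT; last first.
    apply: leq_trans y2; elim: j {jJ p0} => [|j IH]; first by rewrite expn0.
    by rewrite expnS max_pdivM_le// expn_gt0.
  rewrite ler_pdivlMr ?weight_gt0//; apply: (@le_trans _ _ 2^-1).
    by rewrite ler_piMr// weight_le1.
  have -> : 2^-1 = expR (- ln 2) :> R by rewrite expRN lnK// posrE.
  have -> : npowR (2 ^ j) (2 * complex.Re s) =
    expR (- (2 * complex.Re s * j%:R * ln 2)).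
    by rewrite /npowR natrX lnXn// -mulr_natl; congr expR; ring.
  rewrite ler_expR lerN2 ler_piMl ?ln_ge0 ?ler1n//.
  have h1 : complex.Re s * (2 * J.+1%:R) < 1 by rewrite -ltr_pdivlMr ?mulr_gt0// div1r.
  have h2 : j%:R <= J.+1%:R :> R by rewrite ler_nat ltnW.
  have h3 : complex.Re s * j%:R <= complex.Re s * J.+1%:R by rewrite ler_wpM2l// ltW.
  lra.
apply: (@le_trans _ _ (J.+1%:R * 2^-1)).
  by rewrite ler_pdivlMr// mulrC.
have : forall i, (i <= J.+1)%N ->
  i%:R * 2^-1 <= \sum_(1 <= n < 2 ^ i) kernel_term (complex.Re s) n.
  elim => [|i IH] iJ; first by rewrite mul0r big_geq.
  have i1 : (1 <= 2 ^ i)%N by rewrite expn_gt0.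
  have i2 : (2 ^ i < 2 ^ i.+1)%N by rewrite ltn_exp2l.
  rewrite (@big_cat_nat _ _ _ (2 ^ i))//= ?(ltnW i2)// -natr1 mulrDl mul1r.
  apply: lerD; first by rewrite IH// ltnW.
  rewrite big_ltn// -[leLHS]addr0; apply: lerD; first exact: T.
  rewrite big_nat; apply: sumr_ge0 => n /andP[n0 _]; apply: kernel_term_ge0.
  exact: leq_trans n0.
exact.
Qed.

Lemma A2_tail g (delta : R) : A2 h g -> 0 < delta -> exists N0,
  A2 h (fun n => if (n <= N0)%N then 0 else g n) /\
  A2_norm h (fun n => if (n <= N0)%N then 0 else g n) <= delta.
Proof.
move=> gA d0; pose p N := \sum_(1 <= n < N.+1) A2_term h g n.
have ndp : nondecreasing_seq p.
  apply/nondecreasing_seqP => N; rewrite /p [leRHS]big_nat_recr//= lerDl A2_term_ge0//.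
have pc : cvgn p.
  apply: nondecreasing_is_cvgn => //; exists (A2_norm h g ^+ 2) => _ [N _ <-].
  exact: sum_A2_le.
have [N0 hN0] : exists N0, limn p - p N0 <= delta ^+ 2.
  near \oo => N0; exists N0; rewrite (le_trans (ler_norm _))// ltW//.
  by near: N0; move/cvgrPdist_lt : pc; apply; rewrite exprn_gt0.
exists N0.
set gt := fun n => _.
have [gtA gtn] : A2 h gt /\ A2_norm h gt ^+ 2 <= delta ^+ 2.
  apply: A2_bound => // N; apply: le_trans hN0.
  have t0 n : (n <= N0)%N -> A2_term h gt n = 0.
    by move=> nN; rewrite /A2_term /gt nN modulus0 expr0n mul0r.
  have [NN0|N0N] := leqP N N0.
    rewrite big_nat big1 ?subr_ge0; last first.
      by move=> n /andP[_ nN]; apply: t0; apply: leq_trans NN0.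
    exact: nondecreasing_cvgn_le.
  apply: (@le_trans _ _ (p N - p N0)); last first.
    by rewrite lerD2r; exact: nondecreasing_cvgn_le.
  rewrite /p lerBrDl [X in _ + X](@big_cat_nat _ _ _ N0.+1)//= ?ltnS ?(ltnW N0N)//.
  rewrite [X in _ + (X + _)]big_nat [X in _ + (X + _)]big1 ?add0r; last first.
    by move=> n /andP[_ nN]; apply: t0.
  rewrite [leRHS](@big_cat_nat _ _ _ N0.+1)//= ?ltnS ?(ltnW N0N)// lerD2l.
  rewrite big_nat [leRHS]big_nat; apply: ler_sum => n /andP[nN _].
  by rewrite /A2_term /gt leqNgt nN.
by split => //; rewrite -(@ler_pXn2r _ 2) ?nnegrE ?A2_norm_ge0// ltW.
Unshelve. all: by end_near. Qed.

(** * Compactness and the ratio of kernel norms *)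

Section Compact.
Variables (c0 : nat) (Phi : C -> C) (c : nat -> C).
Hypothesis hPhi : c0_symbol c0 Phi c.
Hypothesis cl : forall n : nat, (1 <= n)%N -> (l < max_pdiv n)%N -> c n = 0.

Let cy : smooth_support y c.
Proof.
move=> n n0 yn; apply: cl => //; exact: leq_ltn_trans (nth_prime_ge l) yn.
Qed.

Lemma Re_symbol_gt (s : C) : 0 < complex.Re s ->
  c0%:R * complex.Re s < complex.Re (Phi s).
Proof.
move=> s0; have := symbol_positive hPhi s0.
rewrite /halfplane/=; case: (Phi s) => a b; case: s s0 => u v /= _.
rewrite (_ : (c0%:R : C) = (c0%:R : R)%:C%C); last first.
  by have := @mulrn_real R 1 c0; rewrite mulr1.
by rewrite /= mul0r subr0 subr_gt0.
Qed.

Lemma Re_symbol_gt0 (s : C) : 0 < complex.Re s -> 0 < complex.Re (Phi s).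
Proof.
by move=> s0; apply: le_lt_trans (Re_symbol_gt s0); rewrite mulr_ge0// ltW.
Qed.

(** The relation between a and its image b is known for Re s > 1/2 only.  It
    determines the coefficients of b, and the series found for the composite
    converges, to the right value, on all of Re s > 0. *)
Lemma composition_poly_cvg (a b : nat -> C) N (s : C) :
  smooth_support y a -> (forall n, (N < n)%N -> a n = 0) -> A2 h b ->
  is_composition Phi a b -> 0 < complex.Re s ->
  smooth_support y b /\
  series (dterm b s) @ \oo --> \sum_(1 <= n < N.+1) a n * npow n (Phi s).
Proof.
move=> ay aN bA ab s0.
have [d [dy dr]] := represents_poly_symbol hPhi (ltnW y2) cy N ay.
(* Uniqueness only needs the real points t >= 2. *)
have eqbd n : (0 < n)%N -> b n = d n.
  move=> n0; apply/eqP; rewrite -subr_eq0; apply/eqP.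
  apply: (@dirichlet_unique0 _ (fun n => b n - d n)) n0 => t t2.
  have t0 : 0 < t by lra.
  have [B dB] := dr t%:C%C t0.
  have [B' bB'] := A2_abs_bound bA t2.
  have t12 : halfplane (2^-1) (t%:C%C : C) by rewrite /halfplane/=; lra.
  have bF : represents b t%:C%C B' (\sum_(1 <= n < N.+1) a n * npow n (Phi t%:C%C)).
    split => //; have := abs_bound_cvg bB'.
    have -> : limn (series (dterm b t%:C%C)) = dirichlet b t%:C%C.
      rewrite /dirichlet; congr (limn _); apply/funext => M.
      by rewrite dirichlet_partialE.
    rewrite (ab _ t12) /dirichlet.
    have -> : limn (fun M => dirichlet_partial a M (Phi t%:C%C)) =
      \sum_(1 <= n < N.+1) a n * npow n (Phi t%:C%C).
      apply: ccvg_lim; apply: ccvg_near_cst; near=> M.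
      have NM : (N <= M)%N by near: M; exact: nbhs_infty_ge.
      rewrite /dirichlet_partial (@big_cat_nat _ _ _ N.+1)//= [X in _ +
        X]big_nat [X in _ + X]big1 ?addr0//.
      by move=> m /andP[Nm _]; rewrite aN// mul0r.
    by [].
  have [B'' hB''] := represents_sub bF dB.
  by exists B''; rewrite subrr in hB''.
split; first by move=> n n0 yn; rewrite eqbd// dy.
have [B [_ dF]] := dr s s0.
rewrite (_ : dterm b s = dterm d s)//.
by apply/funext => n; rewrite /dterm eqbd.
Unshelve. all: by end_near. Qed.

Lemma npow_conj n (u : C) : npow n (u^*)%C * npow n u =
  (npowR n (2 * complex.Re u))%:C%C.
Proof.
rewrite -npowD -npow_real; congr npow.
case: u => p q; apply/eqP; rewrite eq_complex /= addNr eqxx andbT; apply/eqP; ring.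
Qed.

(** Points s_k at which the bound fails give truncated kernels at Phi(s_k) whose
    images converge along a subsequence, although their values at s_k remain
    comparable with K(s_k). *)
Lemma kernel_ratio_small : compact_composition h Phi ->
  forall eps : R, 0 < eps -> exists2 theta : R, 0 < theta &
    forall s : C, 0 < complex.Re s < theta ->
      kernel_norm (Phi s) <= eps * kernel_norm s.
Proof.
move=> [Cdef Ccomp] eps eps0; apply: contrapT => neg.
have /choice[s hs] : forall k : nat, exists s : C, 0 < complex.Re s < k.+1%:R^-1 /\
    eps * kernel_norm s < kernel_norm (Phi s).
  move=> k; apply: contrapT => nk; apply: neg; exists (k.+1%:R^-1) => // s sk.
  by rewrite leNgt; apply/negP => lt; apply: nk; exists s.
have s0 k : 0 < complex.Re (s k) by have [/andP[]] := hs k.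
have u0 k : 0 < complex.Re (Phi (s k)) by exact: Re_symbol_gt0.
pose K k := kernel_norm (Phi (s k)).
have K1 k : 1 <= K k by exact: kernel_norm_ge1.
have Kp k : 0 < K k by exact: lt_le_trans (K1 k).
(* The cut-off, chosen so as to keep half of the squared norm. *)
have /choice[N hN] : forall k, exists N,
    K k ^+ 2 / 2 < \sum_(1 <= n < N.+1) kernel_term (complex.Re (Phi (s k))) n.
  move=> k; apply: contrapT => nk.
  have : K k ^+ 2 <= K k ^+ 2 / 2.
    apply: kernel_norm_sqr_le => M; rewrite leNgt; apply/negP => lt.
    by apply: nk; exists M.
  have : 0 < K k ^+ 2 by rewrite exprn_gt0.
  lra.
pose a k n : C := if (n <= N k)%N then ((K k)^-1)%:C%C * partial_kernel h l (Phi (s k)) n else 0.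
have ay k : smooth_support y (a k).
  move=> n n0 yn; rewrite /a; case: ifP => // _.
  by rewrite /partial_kernel leqNgt yn mulr0.
have aN k n : (N k < n)%N -> a k n = 0 by move=> nN; rewrite /a leqNgt nN.
have aA k : A2 h (a k) /\ A2_norm h (a k) <= 1.
  have [aA an] : A2 h (a k) /\ A2_norm h (a k) ^+ 2 <= 1.
    apply: A2_bound => // M.
    apply: (@le_trans _ _ (\sum_(1 <= n < M.+1) (K k ^+ 2)^-1 * kernel_term (complex.Re (Phi (s k))) n)); last first.
      by rewrite -mulr_sumr mulrC ler_pdivrMr ?exprn_gt0// mul1r sum_kernel_term_le.
    rewrite big_nat [leRHS]big_nat; apply: ler_sum => n /andP[n0 _].
    rewrite /A2_term /a; case: ifP => _; last first.
      by rewrite modulus0 expr0n mul0r mulr_ge0 ?invr_ge0 ?sqr_ge0// kernel_term_ge0.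
    rewrite modulusM exprMn -mulrA modulus_partial_kernel// modulus_real.
    by rewrite ger0_norm ?invr_ge0 ?(ltW (Kp k))// exprVn.
  by split => //; rewrite -(@ler_pXn2r _ 2) ?nnegrE ?A2_norm_ge0// expr1n.
have /choice[b hb] : forall k, exists b, A2 h b /\ is_composition Phi (a k) b.
  by move=> k; have [b bA bc] := Cdef (a k) (aA k).1; exists b.
(* Evaluation of b_k at s_k, which has value a_k(Phi(s_k)) >= K_k / 2, is
   dominated by the sum of the moduli. *)
have half k X : (forall M, \sum_(1 <= n < M.+1 | (max_pdiv n <= nth_prime l)%N)
     modulus (b k n) * npowR n (complex.Re (s k)) <= X) -> K k / 2 <= X.
  move=> hX.
  have [by_ bcv] := composition_poly_cvg (ay k) (aN k) (hb k).1 (hb k).2 (s0 k).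
  apply: (@le_trans _ _ (modulus (\sum_(1 <= n < (N k).+1) a k n * npow n (Phi (s k))))).
    have -> : \sum_(1 <= n < (N k).+1) a k n * npow n (Phi (s k)) =
        ((K k)^-1 * \sum_(1 <= n < (N k).+1) kernel_term (complex.Re (Phi (s k))) n)%:C%C.
      rewrite rmorphM/= rmorph_sum/= mulr_sumr big_nat [RHS]big_nat.
      apply: eq_bigr => n /andP[n0 nN]; rewrite /a -ltnS nN -mulrA; congr (_ * _).
      rewrite /partial_kernel /kernel_term; case: ifP => _; last by rewrite mul0r.
      rewrite mulrAC npow_conj rmorphM/= fmorphV.
      by [].
    rewrite modulus_real ger0_norm; last first.
      rewrite mulr_ge0 ?invr_ge0 ?(ltW (Kp k))// big_nat; apply: sumr_ge0 =>
        n /andP[n0 _].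
      exact: kernel_term_ge0.
    rewrite [leRHS]mulrC ler_pdivlMr// mulrAC -expr2.
    exact: ltW (hN k).
  apply: (modulus_lim_le bcv) => M; apply: le_trans (hX M).
  rewrite (le_trans (modulus_sum _ _ _))// [leRHS]big_add1/= [leRHS]big_mkcond/=.
  apply: ler_sum => n _; case: ifP => [_|/negbT];
    first by rewrite /dterm modulusM modulus_npow.
  by rewrite -ltnNge => yn; rewrite /dterm by_// mul0r modulus0.
have [e [g [emono gA eg]]] := Ccomp a b 1 aA hb.
(* The two error terms then add up to eps / 4 times K(s_k), half of the lower
   bound for the value at s_k. *)
pose delta := eps / 8.
have d0 : 0 < delta by rewrite divr_gt0.
have [N0 [gtA gtn]] := A2_tail gA d0.
set gt := fun n => _ in gtA gtn.
pose G := \sum_(1 <= n < N0.+1) modulus (g n).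
have G0 : 0 <= G by apply: sumr_ge0 => n _; exact: modulus_ge0.
have [theta th0 hth] := kernel_norm_unbounded (4 * G / eps + 1).
near \oo => k.
have ek : (k <= e k)%N.
  elim: (k) => // j IH; apply: leq_ltn_trans IH _; exact: emono.
have bg : A2_norm h (fun n => b (e k) n - g n) <= delta.
  rewrite -[leLHS]ger0_norm ?A2_norm_ge0// ltW//.
  by near: k; move/cvgr0Pnorm_lt : eg; exact.
have skth : complex.Re (s (e k)) < theta.
  have [/andP[_ h1] _] := hs (e k).
  apply: lt_le_trans h1 _.
  apply: (@le_trans _ _ (k.+1%:R^-1)).
    by rewrite lef_pV2 ?posrE// ler_nat ltnS.
  rewrite invf_ple ?posrE//.
  have : theta^-1 <= k%:R by near: k; exact: nbhs_infty_ger.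
  by move=> /le_trans -> //; rewrite ler_nat.
have Kbig : 4 * G / eps + 1 <= kernel_norm (s (e k)) by apply: hth; rewrite s0.
have [_ Keps] := hs (e k).
have : K (e k) / 2 <= delta * kernel_norm (s (e k)) + delta * kernel_norm (s (e k)) + G.
  apply: half => M.
  have KS0 : 0 <= kernel_norm (s (e k)) by exact: A2_norm_ge0.
  apply: (@le_trans _ _ (\sum_(1 <= n < M.+1 | (max_pdiv n <= nth_prime l)%N)
      modulus (b (e k) n - g n) * npowR n (complex.Re (s (e k))) +
    \sum_(1 <= n < M.+1 | (max_pdiv n <= nth_prime l)%N) modulus (gt n) * npowR n (complex.Re (s (e k))) +
    \sum_(1 <= n < M.+1) (if (n <= N0)%N then modulus (g n) else 0))); last first.
    apply: lerD; first apply: lerD.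
    - apply: le_trans (@A2_smooth_sum_le (fun n =>
      b (e k) n - g n) _ _ (A2_sub ah (hb _).1 gA) (s0 _)) _.
      exact: ler_wpM2r.
    - apply: le_trans (A2_smooth_sum_le _ gtA (s0 _)) _.
      exact: ler_wpM2r.
    - apply: (@le_trans _ _ (\sum_(1 <= n < (M +
      N0).+1) (if (n <= N0)%N then modulus (g n) else 0))).
        rewrite [leRHS](@big_cat_nat _ _ _ M.+1)//= ?ltnS ?leq_addr// lerDl.
        by apply: sumr_ge0 => n _; case: ifP => // _; exact: modulus_ge0.
      rewrite (@big_cat_nat _ _ _ N0.+1)//= ?ltnS ?leq_addl//.
      rewrite [X in _ + X]big_nat [X in _ + X]big1 ?addr0; last first.
        by move=> n /andP[nN _]; rewrite leqNgt nN.
      rewrite big_nat [leRHS]big_nat; apply: ler_sum => n /andP[_].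
      by rewrite ltnS => ->.
  rewrite [X in _ <= _ + X](bigID (fun n => (max_pdiv n <= nth_prime l)%N))/= addrA.
  rewrite -[leLHS]addr0; apply: lerD; last first.
    by apply: sumr_ge0 => n _; case: ifP => // _; exact: modulus_ge0.
  rewrite -!big_split/= big_nat_cond [leRHS]big_nat_cond; apply: ler_sum =>
    n /andP[/andP[n0 _] _].
  have nle1 : npowR n (complex.Re (s (e k))) <= 1 by rewrite npowR_le1// ltW.
  have nge0 := npowR_ge0 n (complex.Re (s (e k))).
  have := modulusD (b (e k) n - g n) (g n); rewrite subrK.
  have m0 := modulus_ge0 (g n); have m1 := modulus_ge0 (b (e k) n - g n).
  rewrite /gt; case: ifP => _; rewrite ?modulus0 => tri; last by nra.
  apply: le_trans (ler_wpM2r nge0 tri) _; rewrite mulrDl mul0r addr0 lerD2l.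
  by rewrite ler_piMr.
have : eps * (4 * G / eps +
  1) <= eps * kernel_norm (s (e k)) by rewrite ler_wpM2l ?(ltW eps0).
have -> : eps * (4 * G / eps + 1) = 4 * G + eps by field; rewrite gt_eqF.
move: Keps; rewrite /delta -/(K (e k)); lra.
Unshelve. all: by end_near. Qed.

End Compact.
End Kernel.

(** * Gamma integrals and the Bergman weights *)

Section Scaling.
Variable R : realType.
Notation mu := (@lebesgue_measure R).

Lemma measurable_scale (k : R) : measurable_fun [set: measurableTypeR R]
  (( *%R k) : measurableTypeR R -> measurableTypeR R).
Proof. exact: measurable_funM. Qed.

(** The push-forward together with its measure structure, which depends on the
    measurability of the dilation. *)
Definition pushed_lebesgue (k : R) : {measure set (measurableTypeR R) -> \bar R}.
Proof.
unshelve refine (pushforward mu (( *%R k) : measurableTypeR R -> measurableTypeR R) :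
  {measure set (measurableTypeR R) -> \bar R}).
exact: measurable_scale.
Defined.

Lemma lebesgue_measure_scale (k : {posnum R}) (A : set (measurableTypeR R)) :
  measurable A ->
  mu A = mscale (k%:num)%:nng (pushed_lebesgue k%:num) A.
Proof.
apply: lebesgue_measure_unique.
move=> /= _ [[a b] _ <-]/=; rewrite /mscale /pushed_lebesgue/= /pushforward /=.
have -> : *%R k%:num @^-1` `]a, b] = `]a / k%:num, b / k%:num]%classic.
  by apply/seteqP; split => x /=;
    rewrite !in_itv/= ltr_pdivrMr// ler_pdivlMr// (mulrC x).
rewrite !lebesgue_measure_itv/= !lte_fin ltr_pM2r ?invr_gt0//.
case: ifP => _; last by rewrite mule0.
by rewrite -!EFinB -EFinM -mulrBl mulrC divfK.
Qed.

(** Change of variables by a dilation.  It is obtained from the uniqueness of the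
    Lebesgue measure, and so asks for no regularity of [f] at 0, where
    t^{a - 1} may be unbounded. *)
Lemma ge0_integral_scale (k : R) (f : R -> \bar R) : 0 < k ->
  measurable_fun (`]0%R, +oo[ : set R) f -> (forall x, 0 < x -> (0 <= f x)%E) ->
  (\int[mu]_(x in `]0%R, +oo[) f x = k%:E * \int[mu]_(x in `]0%R, +oo[) f (k * x)%R)%E.
Proof.
move=> k0 mf f0; pose c := PosNum k0.
have f0' (x : measurableTypeR R) : (`]0%R, +oo[%classic : set R) x -> (0 <= f x)%E.
  by rewrite /= in_itv/= andbT => /f0.
rewrite (@eq_measure_integral _ _ _ _ (mscale (c%:num)%:nng (pushed_lebesgue c%:num))); last first.
  by move=> A mA _; exact: lebesgue_measure_scale.
rewrite ge0_integral_mscale//.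
congr (_ * _)%E; rewrite /pushed_lebesgue/=.
rewrite ge0_integral_pushforward//.
- rewrite (_ : *%R k @^-1` `]0, +oo[ = `]0, +oo[%classic)//.
  by apply/seteqP; split => x /=; rewrite !in_itv/= !andbT pmulr_rgt0.
- by move=> x; rewrite inE => /f0'.
Qed.

End Scaling.

Section GammaIntegral.
Variable R : realType.
Notation mu := (@lebesgue_measure R).

Definition gamma_fun (a t : R) : R := t `^ (a - 1) * expR (- t).

Lemma measurable_gamma_fun a (D : set (measurableTypeR R)) :
  measurable_fun D (fun t => (gamma_fun a t)%:E).
Proof.
apply: (@measurable_funTS _ _ _ _ D).
apply/measurable_EFinP; apply: measurable_funM; first exact: measurable_powR.
by apply: measurableT_comp => //; exact: measurable_expR.
Qed.

Lemma gamma_fun_ge0 a t : 0 <= gamma_fun a t.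
Proof. by rewrite mulr_ge0 ?powR_ge0 ?expR_ge0. Qed.

(** Covers both signs of the exponent p: the function is monotone, in a
    direction that depends on p. *)
Lemma powR_ge_min (p u v x : R) : 0 < u -> u <= x <= v ->
  Num.min (u `^ p) (v `^ p) <= x `^ p.
Proof.
move=> u0 /andP[ux xv]; have x0 := lt_le_trans u0 ux; have v0 := lt_le_trans x0 xv.
have [p0|p0] := leP 0 p.
  by rewrite ge_min ge0_ler_powR// nnegrE ltW.
rewrite ge_min; apply/orP; right.
rewrite -[p]opprK !(powRN _ (- p)) lef_pV2 ?posrE ?powR_gt0//.
by apply: ge0_ler_powR; rewrite ?nnegrE ?oppr_ge0 ?(ltW p0) ?(ltW x0) ?(ltW v0).
Qed.

Lemma ge0_integral_lower (D : set (measurableTypeR R)) (f : R -> R) (u v k : R) :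
  measurable D -> measurable_fun D (fun t => (f t)%:E) -> (forall x, D x -> 0 <= f x) ->
  u < v -> (`[u, v]%classic : set R) `<=` D -> 0 <= k -> (forall x, u <= x <= v ->
    k <= f x) ->
  ((k * (v - u))%:E <= \int[mu]_(x in D) (f x)%:E)%E.
Proof.
move=> mD mf f0 uv uvD k0 kf.
apply: (@le_trans _ _ (\int[mu]_(x in `[u, v]) (f x)%:E)%E); last first.
  by apply: ge0_subset_integral => // x Dx; rewrite lee_fin f0.
apply: (@le_trans _ _ (\int[mu]_(x in `[u, v]) (cst k%:E x))%E).
  by rewrite integral_cst//= lebesgue_measure_itv/= lte_fin uv -EFinB EFinM.
apply: ge0_le_integral => //.
exact: measurable_funS mf.
Qed.

(** The fundamental theorem of calculus away from the singularity at 0, with a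
    bound independent of the distance d to it. *)
Lemma integral_powR_bounded (a d : R) : 0 < a -> 0 < d < 1 ->
  (\int[mu]_(t in `[d, 1%R]) (t `^ (a - 1))%:E <= (a^-1)%:E)%E.
Proof.
move=> a0 /andP[d0 d1].
pose F := fun t : R => a^-1 * t `^ a.
have dF (x : R) : 0 < x -> is_derive x 1 F (x `^ (a - 1)).
  move=> x0; have h := is_derive1_powR a x0.
  have h2 : is_derive x 1 (a^-1 \*: (@powR R ^~ a : R ->
    R)) (a^-1 *: (a * x `^ (a - 1))).
    exact: is_deriveZ.
  apply: is_derive_eq h2 _.
  by rewrite /GRing.scale/= mulrA mulVf ?mul1r// gt_eqF.
have cF (p x : R) : 0 < x -> {for x, continuous (fun t : R => t `^ p)}.
  move=> x0; apply/differentiable_continuous/derivable1_diffP.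
  by have [] := is_derive1_powR p x0.
have cF' (x : R) : 0 < x -> {for x, continuous F}.
  move=> x0; apply/differentiable_continuous/derivable1_diffP.
  by have [] := dF x x0.
rewrite (@continuous_FTC2 _ _ F)//.
- rewrite -EFinB lee_fin /F powR1 mulr1 gerBl mulr_ge0 ?powR_ge0// invr_ge0 ltW//.
- apply: continuous_in_subspaceT => x; rewrite inE/= in_itv/= => /andP[dx _].
  by apply: cF; exact: lt_le_trans dx.
- split.
  + move=> x; rewrite in_itv/= => /andP[dx _].
    by have [] := dF x (lt_trans d0 dx).
  + by apply/cvg_at_right_filter; exact: cF'.
  + by apply/cvg_at_left_filter; exact: cF'.
- move=> x; rewrite in_itv/= => /andP[dx _].
  by rewrite derive1E; have [_] := dF x (lt_trans d0 dx).
Qed.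

Lemma gamma_lower_lty (a : R) : 0 < a ->
  (\int[mu]_(t in `]0%R, 1%R]) (gamma_fun a t)%:E <= (a^-1)%:E)%E.
Proof.
move=> a0; pose F (n : nat) : set (measurableTypeR R) := `[n.+2%:R^-1, 1]%classic.
have -> : (`]0%R, 1%R]%classic : set R) = \bigcup_n F n.
  apply/seteqP; split => x /=.
    rewrite in_itv/= => /andP[x0 x1]; exists (Num.truncn x^-1) => //.
    rewrite /F/= in_itv/= x1 andbT invf_ple ?posrE//.
    by apply: ltW; apply: (lt_trans (truncnS_gt _)); rewrite ltr_nat.
  move=> [n _]; rewrite /F/= !in_itv/= => /andP[nx ->]; rewrite andbT.
  by apply: lt_le_trans nx; rewrite invr_gt0.
have ndF : nondecreasing_seq F.
  move=> n m nm; rewrite subsetEset => x; rewrite /F/= !in_itv/= => /andP[nx ->].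
  by rewrite andbT (le_trans _ nx)// lef_pV2 ?posrE// ler_nat !ltnS.
have mF i : measurable (F i) by exact: measurable_itv.
have := @ge0_nondecreasing_set_cvg_integral _ _ _ F (fun t =>
  (gamma_fun a t)%:E) mu ndF mF
  (fun i => @measurable_gamma_fun a (F i)) (fun i x _ => gamma_fun_ge0 a x).
move=> cv; apply: (cvge_to_le cv); apply: nearW => n.
have dn : 0 < (n.+2%:R : R)^-1 < 1.
  by rewrite invr_gt0 ltr0n/= invf_lt1 ?ltr0n// ltr1n.
apply: le_trans (integral_powR_bounded a0 dn).
apply: ge0_le_integral => //.
- by move=> x _; rewrite lee_fin gamma_fun_ge0.
- exact: measurable_gamma_fun.
- by apply/measurable_EFinP; apply: measurable_funTS; exact: measurable_powR.
- move=> x; rewrite /F/= in_itv/= => /andP[nx _].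
  rewrite lee_fin /gamma_fun ler_piMr ?powR_ge0// expR_le1 oppr_le0.
  by apply: le_trans nx; rewrite invr_ge0.
Qed.

(** Comparison with one term of the exponential series at t / 2. *)
Lemma powR_le_exp (p : R) : exists2 K : R, 0 <= K & forall t, 1 <= t ->
  t `^ p <= K * expR (t / 2).
Proof.
pose N := Num.truncn p; pose K : R := 2 ^+ N.+1 * N.+1`!%:R.
exists K; first by rewrite mulr_ge0// exprn_ge0.
move=> t t1; have t0 : 0 <= t by exact: le_trans t1.
apply: (@le_trans _ _ (t ^+ N.+1)).
  rewrite -powR_mulrn// ler_powR// ltW// ; exact: truncnS_gt.
have := @expR_ge1Dxn _ (t / 2) N (divr_ge0 t0 (ltW (ltr0Sn _ 1))).
have -> : t ^+ N.+1 = K * ((t / 2) ^+ N.+1 / N.+1`!%:R).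
  rewrite /K expr_div_n; field.
  by rewrite expf_neq0//= pnatr_eq0 -lt0n fact_gt0.
move=> h; apply: ler_wpM2l; first by rewrite mulr_ge0// exprn_ge0.
by apply: le_trans h; rewrite lerDr.
Qed.

Lemma gamma_upper_lty (a : R) :
  (\int[mu]_(t in `]1%R, +oo[) (gamma_fun a t)%:E < +oo)%E.
Proof.
have [K K0 hK] := powR_le_exp (a - 1).
apply: (@le_lt_trans _ _ ((2 * K)%:E)); last exact: ltry.
have h2 : 0 < (2^-1 : R) by [].
have p0 := @exponential_pdf_ge0 R _ (ltW h2).
have mp : measurable_fun setT (fun x => (exponential_pdf (2^-1 : R) x)%:E).
  by apply/measurable_EFinP; exact: measurable_exponential_pdf.
rewrite -[leRHS]mule1 -(integral_exponential_pdf h2).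
rewrite -ge0_integralZl_EFin//; last 2 first.
- by move=> x _; rewrite lee_fin.
- by rewrite mulr_ge0.
apply: (@le_trans _ _ (\int[mu]_(x in `]1%R, +oo[) ((2 * K)%:E * (exponential_pdf (2^-1) x)%:E))%E); last first.
  apply: ge0_subset_integral => //.
  - by apply: measurable_funeM.
  - by move=> x _; rewrite -EFinM lee_fin mulr_ge0 ?mulr_ge0.
apply: ge0_le_integral => //.
- by move=> x _; rewrite lee_fin gamma_fun_ge0.
- exact: measurable_gamma_fun.
- by apply: measurable_funTS; exact: measurable_funeM.
- move=> x /=; rewrite in_itv/= andbT => /ltW x1.
  rewrite -EFinM lee_fin exponential_pdfE; last exact: le_trans x1.
  rewrite /gamma_fun (_ : - x = x / 2 * -1 + - 2^-1 * x); last by field.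
  apply: (@le_trans _ _ (K * expR (x / 2) * expR (x / 2 * -1 + - 2^-1 * x))).
    by rewrite ler_wpM2r ?expR_ge0// hK.
  by rewrite expRD mulrN1 expRN; rewrite le_eqVlt; apply/orP; left; apply/eqP; field;
    rewrite gt_eqF// expR_gt0.
Qed.

Lemma gamma_integral_lty (a : R) : 0 < a ->
  (\int[mu]_(t in `]0%R, +oo[) (gamma_fun a t)%:E < +oo)%E.
Proof.
move=> a0.
have -> : (`]0%R, +oo[%classic : set R) = `]0, 1] `|` `]1, +oo[.
  apply/seteqP; split => x /=; rewrite !in_itv/= !andbT.
    by move=> x0; have [x1|x1] := leP x 1; [left; rewrite x0|right].
  by move=> [/andP[]//|]; exact: lt_trans.
rewrite ge0_integral_setU//=; last 3 first.
- exact: measurable_gamma_fun.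
- by move=> x _; rewrite lee_fin gamma_fun_ge0.
- apply/disj_setPS => x /= []; rewrite !in_itv/= andbT => /andP[_ x1].
  by rewrite ltNge x1.
apply: lte_add_pinfty; last exact: gamma_upper_lty.
exact: le_lt_trans (gamma_lower_lty a0) (ltry _).
Qed.

Lemma gamma_integral_gt0 (a : R) :
  (0 < \int[mu]_(t in `]0%R, +oo[) (gamma_fun a t)%:E)%E.
Proof.
pose k := Num.min (1 `^ (a - 1)) (2 `^ (a - 1)) * expR (- 2) : R.
have k0 : 0 < k by rewrite mulr_gt0 ?expR_gt0// lt_min !powR_gt0.
apply: (@lt_le_trans _ _ ((k * (2 - 1))%:E)).
  by rewrite lte_fin mulr_gt0// subr_gt0 ltr1n.
apply: ge0_integral_lower => //.
- exact: measurable_gamma_fun.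
- by move=> x _; exact: gamma_fun_ge0.
- by rewrite ltr1n.
- by move=> x /=; rewrite !in_itv/= andbT => /andP[x1 _]; exact: lt_le_trans x1.
- exact: ltW.
- move=> x /andP[x1 x2]; apply: ler_pM.
  + by rewrite le_min !powR_ge0.
  + exact: expR_ge0.
  + by apply: powR_ge_min => //; rewrite x1.
  + by rewrite ler_expR lerN2.
Qed.

Lemma GammaE (a : R) : 0 < a ->
  (Gamma a)%:E = (\int[mu]_(t in `]0%R, +oo[) (gamma_fun a t)%:E)%E.
Proof.
move=> a0; rewrite /Gamma /Rintegral fineK// ge0_fin_numE ?gamma_integral_lty//.
exact/ltW/gamma_integral_gt0.
Qed.

Lemma Gamma_gt0 (a : R) : 0 < a -> 0 < Gamma a.
Proof. by move=> a0; rewrite -lte_fin GammaE// gamma_integral_gt0. Qed.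

Lemma integral_powR_exp (a k : R) : 0 < a -> 0 < k ->
  (\int[mu]_(t in `]0%R, +oo[) (t `^ (a - 1) * expR (- (k * t)))%:E =
    (k `^ (- a) * Gamma a)%:E)%E.
Proof.
move=> a0 k0; have kV : 0 < k^-1 by rewrite invr_gt0.
rewrite (@ge0_integral_scale _ k^-1) //; last 2 first.
- apply/measurable_EFinP; apply: measurable_funM.
    by apply: measurable_funTS; exact: measurable_powR.
  by do 2 apply: measurableT_comp => //; exact: measurable_funM.
- by move=> x _; rewrite lee_fin mulr_ge0 ?powR_ge0 ?expR_ge0.
rewrite EFinM GammaE//.
under eq_integral.
  move=> x; rewrite inE/= in_itv/= andbT => x0.
  rewrite mulrA divff ?gt_eqF// mul1r powRM ?(ltW kV) ?(ltW x0)// -mulrA EFinM.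
  over.
rewrite ge0_integralZl_EFin ?powR_ge0//; last 2 first.
- by move=> x _; rewrite lee_fin gamma_fun_ge0.
- exact: measurable_gamma_fun.
rewrite muleA -EFinM; congr (_%:E * _)%E.
by rewrite mulr_powRB1 ?(ltW kV)// -(powR_inv1 (ltW k0)) -powRrM mulN1r.
Qed.
End GammaIntegral.

Section Bergman.
Variable R : realType.
Notation mu := (@lebesgue_measure R).
Variable alpha : R.
Hypothesis alpha1 : -1 < alpha.
Let a := alpha + 1.
Let a0 : 0 < a. Proof. by rewrite /a -ltrBlDr sub0r. Qed.
Let K : R := 2 `^ a / Gamma a.
Let K0 : 0 < K. Proof. by rewrite divr_gt0 ?powR_gt0 ?Gamma_gt0. Qed.

Lemma bergman_densityE x : bergman_density alpha x =
  K * (x `^ (a - 1) * expR (- (2 * x))).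
Proof. by rewrite /bergman_density -/a -/K /a addrK mulrA. Qed.

Lemma measurable_bergman (D : set (measurableTypeR R)) :
  measurable_fun D (bergman_density alpha).
Proof.
apply: measurable_funTS.
have -> : bergman_density alpha = fun x => K * (x `^ (a - 1) * expR (- (2 * x))).
  by apply/funext => x; exact: bergman_densityE.
apply: measurable_funM => //; apply: measurable_funM; first exact: measurable_powR.
by do 2 apply: measurableT_comp => //; exact: measurable_funM.
Qed.

Lemma bergman_ge0 x : 0 <= bergman_density alpha x.
rewrite bergman_densityE mulr_ge0 ?(ltW K0)//;
  by rewrite mulr_ge0 ?powR_ge0 ?expR_ge0. Qed.

(** Gives the total mass for k = 0 and the n-th weight for k = log n. *)
Lemma integral_bergman (k : R) : 0 <= k ->
  (\int[mu]_(x in `]0%R, +oo[) (expR (- (2 * x * k)) * bergman_density alpha x)%:E =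
   ((1 + k) `^ (- a))%:E)%E.
Proof.
move=> k0; have k1 : 0 < 1 + k by lra.
have E x : expR (- (2 * x * k)) * bergman_density alpha x =
    K * (x `^ (a - 1) * expR (- (2 * (1 + k) * x))).
  rewrite bergman_densityE.
  have -> : - (2 * (1 + k) * x) = - (2 * x * k) + - (2 * x) by ring.
  by rewrite expRD; ring.
under eq_integral do rewrite E EFinM.
rewrite ge0_integralZl_EFin//; last 3 first.
- by move=> x _; rewrite lee_fin mulr_ge0 ?powR_ge0 ?expR_ge0.
- apply/measurable_EFinP; apply: measurable_funM.
    by apply: measurable_funTS; exact: measurable_powR.
  by do 2 apply: measurableT_comp => //; exact: measurable_funM.
- exact: ltW.
rewrite integral_powR_exp// ?mulr_gt0// -EFinM; congr EFin.
rewrite powRM ?(ltW k1)// /K (powRN 2) .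
by field; rewrite !gt_eqF ?powR_gt0 ?Gamma_gt0.
Qed.

Lemma weight_bergman n : (0 < n)%N -> weight (bergman_density alpha) n = (1 +
  ln n%:R) `^ (- a).
Proof.
move=> n0; apply: EFin_inj; rewrite -integral_bergman; last by rewrite ln_ge0// ler1n.
rewrite /weight /Rintegral.
under [in RHS]eq_integral do rewrite -/(npowR n (2 * _)) -powR_npowR//.
rewrite fineK//.
under eq_integral do rewrite powR_npowR//.
by rewrite integral_bergman ?ln_ge0 ?ler1n.
Qed.

Lemma admissible_bergman : admissible_density (bergman_density alpha).
Proof.
split.
- exact: measurable_bergman.
- by move=> x _; exact: bergman_ge0.
- rewrite /density_measure setTI.
  have -> : 1%E = ((1 + 0) `^ (- a))%:E :> \bar R by rewrite addr0 powR1.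
  rewrite -integral_bergman//.
  by apply: eq_integral => x _; rewrite mulr0 oppr0 expR0 mul1r.
- move=> U oU U0.
  have [r /= r0 rU] : exists2 r : R, 0 < r & forall x, `|x| < r -> U x.
    have /nbhs_ballP[r /= r0 rU] := oU 0 U0.
    by exists r => // x xr; apply: rU; rewrite /ball/= sub0r normrN.
  pose u := r / 4; pose v := r / 2.
  have u0 : 0 < u by rewrite /u; lra.
  have uv : u < v by rewrite /u /v; lra.
  pose k := K * (Num.min (u `^ (a - 1)) (v `^ (a - 1)) * expR (- (2 * v))).
  have v0 : 0 < v by exact: lt_trans uv.
  have m0 : 0 < Num.min (u `^ (a - 1)) (v `^ (a - 1)) by rewrite lt_min !powR_gt0.
  have k0 : 0 < k by apply: mulr_gt0 => //; apply: mulr_gt0 => //; exact: expR_gt0.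
  apply: (@lt_le_trans _ _ ((k * (v - u))%:E)).
    by rewrite lte_fin mulr_gt0// subr_gt0.
  apply: ge0_integral_lower => //.
  + by apply: measurableI; [exact: open_measurable|exact: measurable_itv].
  + by apply/measurable_EFinP; exact: measurable_bergman.
  + by move=> x _; exact: bergman_ge0.
  + move=> x /=; rewrite !in_itv/= andbT => /andP[ux xv]; split;
    last exact: lt_le_trans ux.
    by apply: rU; rewrite ger0_norm; move: ux xv; rewrite /u /v; lra.
  + exact: ltW.
  + move=> x /andP[ux xv]; rewrite bergman_densityE /k ler_wpM2l ?(ltW K0)//.
    apply: ler_pM.
    * by rewrite le_min !powR_ge0.
    * exact: expR_ge0.
    * by apply: powR_ge_min => //; rewrite ux.
    * by rewrite ler_expR lerN2 ler_wpM2l.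
Qed.

End Bergman.

(** * Doubling of the kernel norms *)

Lemma prod_primes_le_fact n y : (max_pdiv n <= y)%N ->
  (\prod_(p <- primes n) p <= y`!)%N.
Proof.
move=> ny; rewrite fact_prod.
have pr : perm_eq (primes n) [seq i <- index_iota 1 y.+1 | i \in primes n].
  apply: uniq_perm; [exact: primes_uniq|by rewrite filter_uniq// iota_uniq|].
  move=> p; rewrite mem_filter mem_index_iota; apply/idP/andP => [pn|[]//].
  split=> //; rewrite ltnS (leq_trans _ ny) ?andbT.
    by rewrite prime_gt0//; move: pn; rewrite mem_primes => /andP[].
  by apply: max_pdiv_max; rewrite inE.
rewrite (perm_big _ pr)/= big_filter [leqRHS](bigID (fun i => i \in primes n))/=.
rewrite leq_pmulr// big_nat_cond; apply: prodn_cond_gt0 => i /andP[/andP[]] //.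
Qed.

(** m takes half of each exponent of n, rounded down, and r is a product of
    distinct prime divisors of n. *)
Lemma square_times_bounded n y : (0 < n)%N -> (max_pdiv n <= y)%N ->
  exists m r, [/\ n = (m * m * r)%N, (0 < m)%N, (0 < r <= y`!)%N & (max_pdiv m <= y)%N].
Proof.
move=> n0 ny.
pose m := (\prod_(p <- primes n) p ^ (logn p n)./2)%N.
pose r := (\prod_(p <- primes n) p ^ odd (logn p n))%N.
have ppos p : p \in primes n -> (0 < p)%N.
  by rewrite mem_primes => /andP[/prime_gt0].
have E : n = (m * m * r)%N.
  rewrite {1}(prod_prime_decomp n0) prime_decompE big_map /=.
  rewrite /m /r -!big_split/=; apply: eq_bigr => p _.
  by rewrite -!expnD addnn addnC odd_double_half.
have m0 : (0 < m)%N by move: n0; rewrite E; case: (m).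
have r0 : (0 < r)%N by move: n0; rewrite E; case: (r) => //; rewrite muln0.
exists m, r; split => //.
  rewrite r0/= (leq_trans _ (prod_primes_le_fact ny))// /r.
  rewrite big_seq [leqRHS]big_seq; apply: leq_prod => p pn.
  by case: (odd _); rewrite ?expn0 ?expn1// ppos.
apply: leq_trans ny; apply: max_pdiv_dvd_le => //.
by rewrite E -mulnA dvdn_mulr.
Qed.

Section Doubling.
Variable R : realType.
Notation C := (R[i]^o).
Variables (h : R -> R) (b : R).
Hypothesis ah : admissible_density h.
Hypothesis b0 : 0 <= b.
Hypothesis wh : forall n, (0 < n)%N -> weight h n = (1 + ln n%:R) `^ (- b).
Variable l : nat.

Lemma kernel_norm_le (s t : C) : 0 < complex.Re t -> complex.Re t <= complex.Re s ->
  kernel_norm h l s ^+ 2 <= kernel_norm h l t ^+ 2.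
Proof.
move=> t0 ts; apply: kernel_norm_sqr_le => // N.
apply: le_trans (sum_kernel_term_le ah l N.+1 t0).
rewrite big_nat [leRHS]big_nat; apply: ler_sum => n /andP[n0 _].
rewrite /kernel_term; case: ifP => // _.
apply: ler_wpM2r; first by rewrite invr_ge0 ltW// weight_gt0.
by apply: le_npowR => //; rewrite ler_wpM2l.
Qed.

(** With n = m^2 r, the power n^{- 2 sigma} is at most m^{- 4 sigma}, and
    1 + log n <= (2 + L) (1 + log m) when log r <= L. *)
Lemma kernel_term_square_le : exists2 D : R, 1 <= D &
  forall sigma m r, 0 < sigma -> (0 < m)%N -> (0 < r <= (nth_prime l)`!)%N ->
    (max_pdiv m <= nth_prime l)%N ->
    kernel_term h l sigma (m * m * r) <= D * kernel_term h l (2 * sigma) m.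
Proof.
pose L : R := ln (nth_prime l)`!%:R.
have L0 : 0 <= L by rewrite ln_ge0// ler1n fact_gt0.
exists ((2 + L) `^ b).
  by rewrite -[leLHS](powRr0 (2 + L)) ler_powR//; lra.
move=> sigma m r s0 m0 /andP[r0 rR] sm.
have lm0 : 0 <= ln (m%:R : R) by rewrite ln_ge0// ler1n.
have lr0 : 0 <= ln (r%:R : R) by rewrite ln_ge0// ler1n.
rewrite {2}/kernel_term sm wh//.
rewrite /kernel_term; case: ifP => _; last first.
  by rewrite !mulr_ge0 ?npowR_ge0 ?invr_ge0 ?powR_ge0.
have mm0 : (0 < m * m)%N by rewrite muln_gt0 m0.
have n0 : (0 < m * m * r)%N by rewrite muln_gt0 mm0.
rewrite wh// !powRN !invrK mulrCA.
rewrite -powRM; [|lra..].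
apply: ler_pM; rewrite ?npowR_ge0 ?powR_ge0//.
  rewrite npowRM// npowRM// -npowRD (_ : 2 * sigma + 2 * sigma = 2 * (2 * sigma));
    last by ring.
  by rewrite ler_piMr ?npowR_ge0// npowR_le1// mulr_ge0// ltW.
have lE : ln ((m * m * r)%:R : R) = ln m%:R + ln m%:R + ln r%:R.
  by rewrite !natrM !lnM ?posrE ?mulr_gt0 ?ltr0n.
have lrL : ln (r%:R : R) <= L by rewrite ler_ln ?posrE ?ltr0n ?fact_gt0// ler_nat.
apply: ge0_ler_powR => //; rewrite ?nnegrE ?lE.
- by rewrite !addr_ge0.
- by rewrite mulr_ge0//; lra.
- nra.
Qed.

(** Each term of the left-hand series is charged to a pair (m, r) with n = m^2 r;
    every pair is charged by a single n, and r takes at most p_l! values. *)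
Lemma kernel_norm_doubling : exists2 D : R, 1 <= D & forall s t : C,
  0 < complex.Re s -> 0 < complex.Re t -> complex.Re t <= 2 * complex.Re s ->
  kernel_norm h l s ^+ 2 <= D * kernel_norm h l t ^+ 2.
Proof.
have [D D1 hD] := kernel_term_square_le.
pose Q := (nth_prime l)`!; exists (Q%:R * D).
  by rewrite -[leLHS]mulr1; apply: ler_pM => //; rewrite ler1n fact_gt0.
move=> s t s0 t0 ts; apply: kernel_norm_sqr_le => // N.
set sigma := complex.Re s.
have D0 : 0 <= D by lra.
have kt := @kernel_term_ge0 _ _ ah l (2 * sigma).
pose T := \sum_(1 <= m < N.+1) kernel_term h l (2 * sigma) m.
apply: (@le_trans _ _ (Q%:R * D * T)); last first.
  rewrite ler_wpM2l ?mulr_ge0//.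
  pose s2 : C := (2 * sigma)%:C%C.
  have s20 : 0 < complex.Re s2 by rewrite /= mulr_gt0.
  apply: le_trans (sum_kernel_term_le ah l N.+1 s20) _.
  exact: kernel_norm_le.
pose f m r n : R := if n == (m * m * r)%N then D * kernel_term h l (2 * sigma) m else 0.
have f0 m r n : (0 < m)%N -> 0 <= f m r n.
  by move=> m0; rewrite /f; case: ifP => // _; rewrite mulr_ge0// kt.
apply: (@le_trans _ _ (\sum_(1 <= n < N.+1) \sum_(1 <= m < N.+1) \sum_(1 <= r < Q.+1) f m r n)).
  rewrite big_nat [leRHS]big_nat; apply: ler_sum => n /andP[n0 nN].
  have S0 : 0 <= \sum_(1 <= m < N.+1) \sum_(1 <= r < Q.+1) f m r n.
    by rewrite big_nat; apply: sumr_ge0 => m /andP[m0 _]; apply: sumr_ge0 => r _;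
      exact: f0.
  have [ny|yn] := leqP (max_pdiv n) (nth_prime l); last first.
    by rewrite /kernel_term leqNgt yn.
  have [m [r [nE m0 /andP[r0 rQ] my]]] := square_times_bounded n0 ny.
  have mN : (m < N.+1)%N.
    apply: leq_ltn_trans nN; rewrite nE -mulnA leq_pmulr// muln_gt0 m0//.
  have mI : m \in index_iota 1 N.+1 by rewrite mem_index_iota m0.
  have rI : r \in index_iota 1 Q.+1 by rewrite mem_index_iota r0.
  rewrite (bigD1_seq m)//= ?iota_uniq// (bigD1_seq r)//= ?iota_uniq// -addrA.
  rewrite -[leLHS]addr0; apply: lerD.
    by rewrite /f nE eqxx; apply: hD => //; rewrite r0.
  apply: addr_ge0.
    by apply: sumr_ge0 => i _; exact: f0.
  rewrite big_nat_cond; apply: sumr_ge0 => i /andP[/andP[i0 _] _].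
  by apply: sumr_ge0 => j _; exact: f0.
rewrite exchange_big/= /T mulr_sumr big_nat [leRHS]big_nat; apply: ler_sum =>
  m /andP[m0 _].
rewrite exchange_big/= -mulrA.
apply: (@le_trans _ _ (\sum_(1 <= r < Q.+1) D * kernel_term h l (2 * sigma) m));
  last first.
  by rewrite sumr_const_nat subn1 -[leLHS]mulr_natl.
apply: ler_sum => r _.
have [rin|rout] := boolP ((m * m * r)%N \in index_iota 1 N.+1).
  rewrite (bigD1_seq (m * m * r)%N)//= ?iota_uniq// big1 ?addr0; last first.
    by move=> n /negbTE nn; rewrite /f nn.
  by rewrite /f eqxx.
rewrite big_seq big1 ?mulr_ge0 ?kt// => n nin; rewrite /f; case: eqP => // nn.
by move: rout; rewrite -nn nin.
Qed.

Lemma kernel_norm_comparable k : exists2 D : R, 1 <= D & forall s t : C,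
  0 < complex.Re s -> 0 < complex.Re t -> complex.Re t <= 2 ^+ k * complex.Re s ->
  kernel_norm h l s ^+ 2 <= D * kernel_norm h l t ^+ 2.
Proof.
have [D D1 hD] := kernel_norm_doubling.
elim: k => [|k [E E1 hE]].
  exists 1 => // s t s0 t0; rewrite expr0 !mul1r; exact: kernel_norm_le.
exists (D * E); first by rewrite -[leLHS]mulr1; apply: ler_pM.
move=> s t s0 t0 ts; pose u : C := (2 * complex.Re s)%:C%C.
have u0 : 0 < complex.Re u by rewrite /= mulr_gt0.
apply: le_trans (hD s u s0 u0 (lexx _)) _.
rewrite -mulrA ler_wpM2l//; first by lra.
by apply: hE => //=; rewrite mulrA -exprSr.
Qed.
End Doubling.

(** * The limits at the boundary *)

Lemma tends_to0_at_boundaryP (R : realType) (F : R[i]^o -> R) :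
  (forall eps : R, 0 < eps -> exists2 theta : R, 0 < theta &
     forall s : R[i]^o, 0 < complex.Re s < theta -> `|F s| <= eps) ->
  tends_to0_at_boundary F.
Proof.
move=> H; rewrite /tends_to0_at_boundary.
pose S (theta : R) : \bar R :=
  ereal_sup [set `|F s|%:E | s in [set s : R[i]^o | 0 < complex.Re s < theta]].
have S_ge0 theta : 0 < theta -> (0 <= S theta)%E.
  move=> th0; apply: (@le_trans _ _ (`|F (theta / 2)%:C%C|%:E));
    first by rewrite lee_fin.
  apply: ereal_sup_ubound; exists (theta / 2)%:C%C => //=.
  by rewrite divr_gt0//= ltr_pdivrMr// ltr_pMr// ltr1n.
have S_near (eps : R) : 0 < eps -> \forall theta \near 0^'+, (0 <= S theta <= eps%:E)%E.
  move=> eps0; have [t0 t00 ht0] := H eps eps0.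
  near=> theta.
  have th0 : 0 < theta by near: theta; exact: nbhs_right_gt.
  have tt : theta < t0 by near: theta; exact: nbhs_right_lt.
  rewrite S_ge0//=; apply: ge_ereal_sup => _ [s /= /andP[s0 st] <-].
  by rewrite lee_fin ht0// s0 (lt_trans st).
apply/fine_cvgP; split.
  near=> theta; have /andP[S0 S1] : (0 <= S theta <= 1%:E)%E.
    by near: theta; exact: S_near.
  by rewrite -/(S theta) ge0_fin_numE// (le_lt_trans S1)// ltry.
apply/cvgr0Pnorm_le => eps eps0; near=> theta.
have /andP[S0 S1] : (0 <= S theta <= eps%:E)%E by near: theta; exact: S_near.
rewrite /= -/(S theta) ger0_norm ?fine_ge0// -lee_fin fineK//.
by rewrite ge0_fin_numE// (le_lt_trans S1)// ltry.
Unshelve. all: by end_near. Qed.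

Theorem corollary3 (R : realType) (c0 l : nat)
    (Phi : R[i]^o -> R[i]^o) (c : nat -> R[i]^o)
    (hc0 : (1 <= c0)%N) (hl : (1 <= l)%N)
    (hPhi : c0_symbol c0 Phi c)
    (hc : forall n : nat, (1 <= n)%N -> (l < max_pdiv n)%N -> c n = 0) :
  (forall h : R -> R, admissible_density h -> compact_composition h Phi ->
     tends_to0_at_boundary (fun s : R[i]^o =>
       A2_norm h (partial_kernel h l (Phi s)) /
       A2_norm h (partial_kernel h l s))) /\
  (forall alpha : R, -1 < alpha ->
     compact_composition (bergman_density alpha) Phi ->
     tends_to0_at_boundary (fun s : R[i]^o =>
       complex.Re s / complex.Re (Phi s))).
Proof.
split=> [h ah hcomp|alpha alpha1 hcomp]; apply: tends_to0_at_boundaryP => eps eps0.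
  have [theta th0 hth] := kernel_ratio_small ah hl hPhi hc hcomp eps0.
  exists theta => // s sth; have /andP[s0 _] := sth.
  have K0 : 0 < kernel_norm h l s := lt_le_trans ltr01 (kernel_norm_ge1 ah hl s0).
  rewrite ger0_norm; last by rewrite divr_ge0 ?A2_norm_ge0.
  by rewrite ler_pdivrMr//; exact: hth.
have ah := admissible_bergman alpha1.
have wh := weight_bergman alpha1.
have a0 : 0 <= alpha + 1 by rewrite -lerBlDr sub0r ltW.
(* If Re s / Re Phi(s) > eps then Re Phi(s) <= 2^k Re s. *)
have [k hk] : exists k : nat, eps^-1 <= 2 ^+ k.
  exists (Num.truncn eps^-1).+1; apply: le_trans (ltW (truncnS_gt _)) _.
  by rewrite -natrX ler_nat ltnW// ltn_expl.
have [D D1 hD] := kernel_norm_comparable ah a0 wh l k.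
have eta0 : 0 < (2 * D)^-1 by rewrite invr_gt0; lra.
have [theta th0 hth] := kernel_ratio_small ah hl hPhi hc hcomp eta0.
exists theta => // s sth; have /andP[s0 _] := sth.
have u0 := Re_symbol_gt0 hPhi s0.
rewrite ger0_norm; last by rewrite divr_ge0// ltW.
rewrite leNgt; apply/negP => lt.
have us : complex.Re (Phi s) <= 2 ^+ k * complex.Re s.
  apply: le_trans (ler_wpM2r (ltW s0) hk); rewrite mulrC ler_pdivlMr//.
  by move: lt; rewrite ltr_pdivlMr// mulrC => /ltW.
have h1 := hD _ _ s0 u0 us.
have h2 := hth s sth.
have K0 : 0 < kernel_norm (bergman_density alpha) l s :=
  lt_le_trans ltr01 (kernel_norm_ge1 ah hl s0).
have Ku0 : 0 <= kernel_norm (bergman_density alpha) l (Phi s) by exact: A2_norm_ge0.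
move: h1 h2 K0 Ku0; set X := kernel_norm _ _ s; set Y := kernel_norm _ _ (Phi s).
move=> h1 h2 X0 Y0.
have h3 : Y ^+ 2 <= ((2 * D)^-1 * X) ^+ 2.
  by rewrite lerXn2r ?nnegrE// mulr_ge0// ltW.
have h4 : X ^+ 2 <= D * ((2 * D)^-1 * X) ^+ 2.
  by apply: le_trans h1 _; rewrite ler_wpM2l//; lra.
have e : D * ((2 * D)^-1 * X) ^+ 2 = X ^+ 2 * (4 * D)^-1 by field; lra.
have : (4 * D)^-1 < 1 by rewrite invf_lt1; lra.
have X2 : 0 < X ^+ 2 by rewrite exprn_gt0.
rewrite -(ltr_pM2l X2) mulr1 -e => h5.
by move: (le_lt_trans h4 h5); rewrite ltxx.
Qed.
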